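(* Let $B$ be a densely defined closed symmetric operator with deficiency indices $(1,1)$ on a Hilbert space $\mathcal{H}$, with self-adjoint extensions $T_\theta$, $\theta\in[0,\pi)$, and let $\mathcal{M}$ be the cyclicity space of the deficiency vector $u_+$. Let $\theta_0\in[0,\pi)$ be fixed. Then the set of points in $\sigma(T_{\theta_0}\upharpoonright_{\mathcal{M}})$ which are not eigenvalues of $T_\theta\upharpoonright_{\mathcal{M}}$ for any $\theta\in[0,\pi)$ with $\theta\ne\theta_0$ is a dense $G_\delta$ set in $\sigma(T_{\theta_0}\upharpoonright_{\mathcal{M}})$.
   Context: $\mathcal{H}$ is a complex Hilbert space. The deficiency spaces of $B$ are $K_\pm(B)=\mathrm{Ran}(B\pm iI)^\perp=\mathrm{Ker}(B^*\mp iI)$, both one-dimensional; $u_\pm\in K_\pm(B)$ are fixed unit vectors, and $u_+$ is called the deficiency vector. For $\theta\in[0,\pi)$, $T_\theta$ is the self-adjoint extension of $B$ with domain $D(T_\theta)=D(B)\dotplus\mathrm{span}\{u_++e^{-2i\theta}u_-\}$ and $T_\theta(x+au_++ae^{-2i\theta}u_-)=Bx+aiu_+-aie^{-2i\theta}u_-$ for $x\in D(B)$, $a\in\mathbb{C}$. The cyclicity space of $u_+$ is $\mathcal{M}=\overline{\mathrm{span}\{(T_\theta-zI)^{-1}u_+:z\in\mathbb{C}\setminus\mathbb{R}\}}$; it does not depend on $\theta$ and reduces every $T_\theta$. $T_\theta\upharpoonright_{\mathcal{M}}$ is the self-adjoint operator on $\mathcal{M}$ with domain $D(T_\theta)\cap\mathcal{M}$.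 $\sigma$ denotes spectrum. *)

(* Defs.v *)
From HB Require Import structures.
From mathcomp Require Import all_boot all_order all_algebra.
From mathcomp Require Import complex.
From mathcomp Require Import all_classical all_reals all_analysis borel_hierarchy.

Set Implicit Arguments.
Unset Strict Implicit.
Unset Printing Implicit Defensive.

Import Order.TTheory GRing.Theory Num.Theory numFieldNormedType.Exports.
Local Open Scope complex_scope.
Local Open Scope classical_set_scope.
Local Open Scope ring_scope.

Section LinearSpaces.
Variables (R : realType) (V : lmodType R[i]).

Definition linear_subspace (S : set V) : Prop := submod_closed (mem S).

Definition linear_span (A : set V) : set V := smallest linear_subspace A.

Definition one_dimensional (S : set V) : Prop :=
  exists2 u : V, u != 0 & S = range (fun a : R[i] => a *: u).

End LinearSpaces.

(* A complex Hilbert space is a complete normed module H over R[i] together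
   with an inner product dot (linear in its first argument) that induces the
   norm.  The norm of H takes its values in R[i]. *)
Definition induces_norm (R : realType) (H : completeNormedModType R[i])
    (dot : {dot H for Num.conj}) : Prop :=
  forall x : H, `|x| ^+ 2 = dot x x.

(* A possibly unbounded operator is represented by its graph: (x, y) \in T
   means that x belongs to the domain of T and y = T x. *)
Section Operators.
Variables (R : realType) (H : completeNormedModType R[i]).
Variable (dot : {dot H for Num.conj}).
Implicit Types (B T : set (H * H)) (K M : set H) (z : R[i]).

Definition linear_operator T : Prop :=
  linear_subspace T /\
  (forall x y y' : H, T (x, y) -> T (x, y') -> y = y').

Definition domain T : set H := [set p.1 | p in T].

Definition ran T : set H := [set p.2 | p in T].

Definition densely_defined T : Prop := dense (domain T).

Definition closed_operator T : Prop := closed T.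

Definition symmetric_operator T : Prop :=
  forall x y x' y' : H, T (x, y) -> T (x', y') -> dot y x' = dot x y'.

(* T - z I *)
Definition op_shift T z : set (H * H) := [set (p.1, p.2 - z *: p.1) | p in T].

Definition orthocomplement (A : set H) : set H :=
  [set v | forall w : H, A w -> dot v w = 0].

(* Ran (B + z I)^\perp, so that K_+(B) and K_-(B) are obtained for z = i and
   z = - i respectively *)
Definition deficiency_space B z : set H :=
  orthocomplement (ran (op_shift B (- z))).

Definition restriction T M : set (H * H) := [set p | T p /\ M p.1].

Definition is_eigenvalue T z : Prop := exists2 x : H, x != 0 & T (x, z *: x).

(* Resolvent set of T viewed as an operator on the Hilbert space K, a closed
   subspace of H: T - z I is a bijection from the domain of T onto K, with
   bounded inverse. *)
Definition resolvent_set K T : set R[i]^o :=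
  [set z | [/\ ran (op_shift T z) = K,
    (forall x x' y : H, op_shift T z (x, y) -> op_shift T z (x', y) -> x = x') &
    exists c : R[i], forall x y : H, op_shift T z (x, y) -> `|x| <= c * `|y| ]].

Definition spectrum K T : set R[i]^o := ~` resolvent_set K T.

(* (T - z I)^-1 v, with junk value 0 when v is not in the range of T - z I *)
Definition resolvent T z (v : H) : H := xget 0 [set w | op_shift T z (w, v)].

Definition cyclicity_space T (u : H) : set H :=
  closure (linear_span
    [set resolvent T z u | z in [set z : R[i] | z \isn't Num.real]]).

(* e^{it} *)
Definition expi (t : R) : R[i] := cos t +i* sin t.

(* The extension T_theta of B attached to the deficiency vectors up, um *)
Definition extension B (up um : H) (theta : R) : set (H * H) :=
  [set p | exists x y : H, exists a : R[i],
    B (x, y) /\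
    p = (x + a *: up + (a * expi (- (2 * theta))) *: um,
         y + (a * 'i%C) *: up - (a * 'i%C * expi (- (2 * theta))) *: um)].

End Operators.

(* Main.v *)
Require Import Defs.
From HB Require Import structures.
From mathcomp Require Import all_boot all_order all_algebra.
From mathcomp Require Import complex.
From mathcomp Require Import all_classical all_reals all_analysis borel_hierarchy.
From mathcomp Require Import cyclic separable cyclotomic.
From mathcomp Require Import ring lra.

Set Implicit Arguments.
Unset Strict Implicit.
Unset Printing Implicit Defensive.

Import Order.TTheory GRing.Theory Num.Theory numFieldNormedType.Exports.
Local Open Scope complex_scope.
Local Open Scope classical_set_scope.
Local Open Scope ring_scope.

(** Write T for the extension of parameter theta0, u for u_+, and work in the
    cyclic subspace M, which reduces T. The first step is algebraic: a real l is an
    eigenvalue in M of some other extension if and only if (T - l) w = u has a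
    solution w in M ([eigenvalue_of_solution], [solution_of_eigenvalue]). Indeed
    u + (l - i) w is then in the kernel of B* - l, and elements of that kernel lie
    in the domain of some extension because l is real. It remains to show that the
    points l of the spectrum for which the equation has no solution form a dense
    G_delta.

    In terms of the spectral measure mu of u, solvability with |w| <= n means that
    G(l), the integral of 1 / (s - l)^2 with respect to mu, is at most n^2. As G is
    lower semicontinuous these sets are closed, which gives the G_delta property
    ([range_dual], [not_solvable_open]). By the Baire category theorem in the
    spectrum, density fails only if G is bounded by a constant on the part of the
    spectrum that lies in some interval I around one of its points. But G(l) <= n^2
    forces mu to have mass at most n^2 r^2 in the interval of radius r around l;
    covering I by 1/r such intervals shows that mu has mass O(r) in I for every r.
    So I carries no spectral mass, and since u is cyclic I does not meet the
    spectrum.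

    The argument is carried out without a spectral measure. Boundary values of
    resolvents are obtained from a monotonicity identity
    ([resolvent_diff_sqr], [bounded_resolvents_range]). The covering argument takes
    place on the unit circle, for the Cayley transform U of T: the spectral
    projections of arcs of length 1/m are replaced by the averages of U^k x against
    the m-th roots of unity, which resolve the identity exactly and are
    eigenvectors of U up to O(1/m) ([spec_avg_parseval], [spec_avg_shift],
    [arc_lower_bound]). It requires bounded solutions at all points of I, including
    the gaps of the spectrum; there they are supplied by the same covering argument
    applied to all vectors of M at once ([gap_bounded_below],
    [solvable_near_gap]). *)

(** * Linear identities in a module *)

Inductive lincomb (K : Type) : Type :=
  | LVar of nat
  | LZero
  | LAdd of lincomb K & lincomb K
  | LOpp of lincomb K
  | LScale of K & lincomb K.

Section LinearCombinations.
Variables (K : nzRingType) (V : lmodType K).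

Fixpoint lc_eval (env : seq V) (e : lincomb K) : V :=
  match e with
  | LVar n => nth 0 env n
  | LZero => 0
  | LAdd e1 e2 => lc_eval env e1 + lc_eval env e2
  | LOpp e1 => - lc_eval env e1
  | LScale a e1 => a *: lc_eval env e1
  end.

Fixpoint lc_coef (k : nat) (e : lincomb K) : K :=
  match e with
  | LVar n => if eqn n k then 1 else 0
  | LZero => 0
  | LAdd e1 e2 => lc_coef k e1 + lc_coef k e2
  | LOpp e1 => - lc_coef k e1
  | LScale a e1 => a * lc_coef k e1
  end.

Fixpoint lc_agree (n : nat) (e1 e2 : lincomb K) : Prop :=
  match n with
  | 0%N => True
  | m.+1 => lc_coef m e1 = lc_coef m e2 /\ lc_agree m e1 e2
  end.

Lemma lc_evalE env e :
  lc_eval env e = \sum_(k < size env) lc_coef k e *: nth 0 env k.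
Proof.
elim: e => [n||e1 IH1 e2 IH2|e1 IH1|a e1 IH1] /=; rewrite ?IH1 ?IH2.
- have [ltn|gen] := ltnP n (size env); last first.
    rewrite nth_default // big1 // => k _.
    case: eqnP => [nk|_]; last by rewrite scale0r.
    by move: (ltn_ord k); rewrite -nk ltnNge gen.
  rewrite (bigD1 (Ordinal ltn)) //= big1 ?addr0 => [|k nk].
    by case: eqnP => // _; rewrite scale1r.
  case: eqnP => [nk'|_]; last by rewrite scale0r.
  by case/negP: nk; apply/eqP/val_inj.
- by rewrite big1 // => k _; rewrite scale0r.
- by rewrite -big_split; apply: eq_bigr => k _; rewrite /= scalerDl.
- by rewrite -sumrN; apply: eq_bigr => k _; rewrite scaleNr.
- by rewrite scaler_sumr; apply: eq_bigr => k _; rewrite scalerA.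
Qed.

Lemma lc_agree_eval env e1 e2 :
  lc_agree (size env) e1 e2 -> lc_eval env e1 = lc_eval env e2.
Proof.
move=> h; rewrite !lc_evalE; apply: eq_bigr => k _; congr (_ *: _).
elim: (size env) h k => [|n IH] /= h [k ltk] //=.
case: h => h1 h2; move: ltk; rewrite ltnS leq_eqVlt => /orP[/eqP -> //|ltk].
exact: (IH h2 (Ordinal ltk)).
Qed.

End LinearCombinations.

Ltac lc_index x env :=
  lazymatch env with
  | cons x _ => constr:(0%N)
  | cons _ ?t => let n := lc_index x t in constr:(S n)
  end.

Ltac lc_insert x env :=
  let rec mem l :=
    lazymatch l with
    | nil => constr:(cons x env)
    | cons x _ => env
    | cons _ ?t => mem t
    end in mem env.

Ltac lc_atoms t env :=
  lazymatch t with
  | (?x + ?y)%R => let env' := lc_atoms x env in lc_atoms y env'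
  | (- ?x)%R => lc_atoms x env
  | (_ *: ?x)%R => lc_atoms x env
  | 0%R => env
  | _ => lc_insert t env
  end.

Ltac lc_reify K t env :=
  lazymatch t with
  | (?x + ?y)%R =>
      let ex := lc_reify K x env in let ey := lc_reify K y env in
      constr:(@LAdd K ex ey)
  | (- ?x)%R => let ex := lc_reify K x env in constr:(@LOpp K ex)
  | (?a *: ?x)%R => let ex := lc_reify K x env in constr:(@LScale K a ex)
  | 0%R => constr:(@LZero K)
  | _ => let n := lc_index t env in constr:(@LVar K n)
  end.

(** [ring] and [field] decide identities between scalars only; an identity
    between linear combinations of vectors is reduced to one scalar identity
    for each vector that occurs in it. *)
Ltac lincomb K :=
  lazymatch goal with
  | |- @eq ?V ?x ?y =>
      let nl := constr:(@nil V) in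
      let env1 := lc_atoms x nl in
      let env := lc_atoms y env1 in
      let ex := lc_reify K x env in
      let ey := lc_reify K y env in
      refine (@lc_agree_eval _ _ env ex ey _);
      cbn [lc_agree lc_coef size eqn]; repeat split
  end.

(** * Moduli of complex numbers and norms of vectors as real numbers *)

Section ComplexNumbers.
Variable R : realType.
Implicit Types (a b z : R[i]) (t : R).

Definition cabs a : R := complex.Re `|a|.

Lemma cabsE a : `|a| = (cabs a)%:C.
Proof. by rewrite /cabs normc_def. Qed.

Lemma cabs_ge0 a : 0 <= cabs a.
Proof. by rewrite -ler0c -cabsE. Qed.

Lemma cabsM a b : cabs (a * b) = cabs a * cabs b.
Proof. by apply: complexI; rewrite rmorphM -!cabsE normrM. Qed.

Lemma cabsN a : cabs (- a) = cabs a.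
Proof. by rewrite /cabs normrN. Qed.

Lemma cabsB a b : cabs (a - b) = cabs (b - a).
Proof. by rewrite /cabs distrC. Qed.

Lemma cabsV a : cabs a^-1 = (cabs a)^-1.
Proof. by apply: complexI; rewrite fmorphV -!cabsE normfV. Qed.

Lemma cabsX a n : cabs (a ^+ n) = cabs a ^+ n.
Proof. by apply: complexI; rewrite rmorphXn -!cabsE normrX. Qed.

Lemma cabsD a b : cabs (a + b) <= cabs a + cabs b.
Proof. by rewrite -lecR rmorphD -!cabsE ler_normD. Qed.

Lemma cabs_real t : cabs t%:C = `|t|.
Proof. by rewrite /cabs normc_def /= expr0n /= addr0 sqrtr_sqr. Qed.

Lemma cabs0 : cabs 0 = 0.
Proof. by rewrite /cabs normr0. Qed.

Lemma cabs1 : cabs 1 = 1.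
Proof. by rewrite /cabs normr1. Qed.

Lemma cabsi : cabs 'i%C = 1.
Proof. by rewrite /cabs normc_def /= expr0n /= add0r expr1n sqrtr1. Qed.

Lemma cabs_sqr a : cabs a ^+ 2 = complex.Re a ^+ 2 + complex.Im a ^+ 2.
Proof. by apply: complexI; rewrite rmorphXn /= -cabsE -add_Re2_Im2. Qed.

Lemma cabs_eq0 a : (cabs a == 0) = (a == 0).
Proof. by rewrite -(inj_eq (@complexI R)) -cabsE normr_eq0. Qed.

Lemma cabs_gt0 a : (0 < cabs a) = (a != 0).
Proof. by rewrite lt_def cabs_eq0 cabs_ge0 andbT. Qed.

Lemma abs_Re_cabs a : `|complex.Re a| <= cabs a.
Proof. by rewrite -lecR -cabsE normc_ge_Re. Qed.

Lemma abs_Im_cabs a : `|complex.Im a| <= cabs a.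
Proof.
rewrite -(ler_pXn2r (n := 2)) ?nnegrE ?cabs_ge0 // cabs_sqr real_normK ?num_real //.
by rewrite lerDr sqr_ge0.
Qed.

Lemma mulCE a b : a * b = (complex.Re a * complex.Re b - complex.Im a * complex.Im b)
   +i* (complex.Re a * complex.Im b + complex.Im a * complex.Re b).
Proof. by case: a b => [a a'] [b b']. Qed.

Lemma Re_mul a b : complex.Re (a * b) =
  complex.Re a * complex.Re b - complex.Im a * complex.Im b.
Proof. by rewrite mulCE. Qed.

Lemma Im_mul a b : complex.Im (a * b) =
  complex.Re a * complex.Im b + complex.Im a * complex.Re b.
Proof. by rewrite mulCE. Qed.

Lemma Re_conjc z : complex.Re (Num.conj z) = complex.Re z.
Proof. by case: z. Qed.

Lemma Im_conjc z : complex.Im (Num.conj z) = - complex.Im z.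
Proof. by case: z. Qed.

Lemma Re_add a b : complex.Re (a + b) = complex.Re a + complex.Re b.
Proof. by case: a b => [a a'] [b b']. Qed.

Lemma Im_add a b : complex.Im (a + b) = complex.Im a + complex.Im b.
Proof. by case: a b => [a a'] [b b']. Qed.

Lemma Re_opp a : complex.Re (- a) = - complex.Re a.
Proof. by case: a. Qed.

Lemma Im_opp a : complex.Im (- a) = - complex.Im a.
Proof. by case: a. Qed.

Lemma complex_ext a b :
  complex.Re a = complex.Re b -> complex.Im a = complex.Im b -> a = b.
Proof. by case: a b => [a a'] [b b'] /= -> ->. Qed.

Lemma mulii : 'i%C * 'i%C = -1 :> R[i].
Proof. by rewrite -expr2 sqr_i. Qed.

Definition ReImE :=
  (Re_add, Im_add, Re_opp, Im_opp, Re_mul, Im_mul, Re_conjc, Im_conjc).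

Lemma nonreal_Im z : (z \isn't Num.real) = (complex.Im z != 0).
Proof. by case: z => a b; rewrite complex_real. Qed.

End ComplexNumbers.

Section HilbertSpace.
Variables (R : realType) (H : completeNormedModType R[i]).
Variable dot : {dot H for Num.conj}.
Hypothesis dot_norm : induces_norm dot.
Implicit Types (x y w : H) (a : R[i]).

Definition nrm x : R := complex.Re `|x|.

Lemma nrmE x : `|x| = (nrm x)%:C.
Proof. by rewrite /nrm RRe_real // normr_real. Qed.

Lemma nrm_ge0 x : 0 <= nrm x.
Proof. by rewrite -ler0c -nrmE. Qed.

Lemma nrmD x y : nrm (x + y) <= nrm x + nrm y.
Proof. by have := ler_normD x y; rewrite !nrmE -rmorphD lecR. Qed.

Lemma nrmN x : nrm (- x) = nrm x.
Proof. by rewrite /nrm normrN. Qed.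

Lemma nrmB x y : nrm (x - y) = nrm (y - x).
Proof. by rewrite /nrm distrC. Qed.

Lemma nrm_triB x y w : nrm (x - w) <= nrm (x - y) + nrm (y - w).
Proof. by rewrite -(subrKA y x); apply: le_trans (nrmD _ _). Qed.

Lemma nrmZ a x : nrm (a *: x) = cabs a * nrm x.
Proof. by have := normrZ a x; rewrite !nrmE cabsE -rmorphM => /complexI. Qed.

Lemma nrm0 : nrm 0 = 0.
Proof. by rewrite /nrm normr0. Qed.

Lemma nrm_eq0 x : (nrm x == 0) = (x == 0).
Proof. by rewrite -(normr_eq0 x) nrmE -(inj_eq (@complexI R)). Qed.

Lemma nrm_gt0 x : (0 < nrm x) = (x != 0).
Proof. by rewrite lt_def nrm_eq0 nrm_ge0 andbT. Qed.

Lemma nrm_le0 x : nrm x <= 0 -> x = 0.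
Proof.
by move=> h; apply/eqP; rewrite -nrm_eq0 eq_le h nrm_ge0.
Qed.

Lemma dotDl x y w : dot (x + y) w = dot x w + dot y w.
Proof. exact: linearDl. Qed.
Lemma dotDr x y w : dot w (x + y) = dot w x + dot w y.
Proof. exact: linearDr. Qed.
Lemma dotNl x w : dot (- x) w = - dot x w.
Proof. exact: linearNl. Qed.
Lemma dotNr x w : dot w (- x) = - dot w x.
Proof. exact: linearNr. Qed.
Lemma dot0l w : dot 0 w = 0.
Proof. exact: linear0l. Qed.
Lemma dot0r w : dot w 0 = 0.
Proof. exact: linear0r. Qed.
Lemma dotZl a x w : dot (a *: x) w = a * dot x w.
Proof. exact: linearZl_LR. Qed.
Lemma dotZr a x w : dot w (a *: x) = Num.conj a * dot w x.
Proof. exact: linearZr_LR. Qed.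
Lemma dotC x y : dot x y = Num.conj (dot y x).
Proof. by rewrite hermC expr0 mul1r. Qed.

Definition dotE := (dotDl, dotDr, dotNl, dotNr, dotZl, dotZr).

Lemma dotxx x : dot x x = (nrm x ^+ 2)%:C.
Proof. by rewrite -dot_norm nrmE rmorphXn. Qed.

Lemma nrm_sqr x : nrm x ^+ 2 = complex.Re (dot x x).
Proof. by rewrite dotxx. Qed.

Lemma Im_dotxx x : complex.Im (dot x x) = 0.
Proof. by rewrite dotxx. Qed.

Lemma nrm_sqrD x y :
  nrm (x + y) ^+ 2 = nrm x ^+ 2 + nrm y ^+ 2 + 2 * complex.Re (dot x y).
Proof.
rewrite !nrm_sqr !dotE !Re_add (dotC y x) Re_conjc; ring.
Qed.

Lemma nrm_sqrB x y :
  nrm (x - y) ^+ 2 = nrm x ^+ 2 + nrm y ^+ 2 - 2 * complex.Re (dot x y).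
Proof. by rewrite nrm_sqrD nrmN dotNr Re_opp mulrN. Qed.

Lemma cauchy_schwarz x y : cabs (dot x y) <= nrm x * nrm y.
Proof.
have [->|y0] := eqVneq y 0; first by rewrite dot0r cabs0 nrm0 mulr0.
have ny0 : 0 < nrm y by rewrite nrm_gt0.
set d := dot x y.
have := sqr_ge0 (nrm (((nrm y ^+ 2)%:C) *: x - d *: y)).
rewrite nrm_sqrB !nrmZ cabs_real dotZl dotZr -/d.
have -> : Num.conj d * d = (cabs d ^+ 2)%:C.
  by apply: complex_ext; rewrite ?ReImE /= ?cabs_sqr; ring.
rewrite !Re_mul /= ger0_norm ?sqr_ge0 // => h.
rewrite -(ler_pXn2r (n := 2)) ?nnegrE ?cabs_ge0 ?mulr_ge0 ?nrm_ge0 //.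
rewrite -(ler_pM2l (exprn_gt0 2 ny0)) -subr_ge0.
apply: le_trans h _; rewrite le_eqVlt; apply/orP; left; apply/eqP; ring.
Qed.

Lemma parallelogram x y :
  nrm (x + y) ^+ 2 + nrm (x - y) ^+ 2 = 2 * (nrm x ^+ 2 + nrm y ^+ 2).
Proof. rewrite nrm_sqrB nrm_sqrD; ring. Qed.

(** * Limits in the real-valued norm *)

Lemma closed_limit (A : set H) x : closed A ->
  (forall e : R, 0 < e -> exists2 y, A y & nrm (x - y) < e) -> A x.
Proof.
move=> cA h; rewrite (_ : A = closure A); last by rewrite -(closure_id A).1.
move=> U /nbhs_ballP[[e e'] /= e0 eU].
move: e0; rewrite ltcE /= => /andP[/eqP e'0 e0].
have [y Ay xy] := h e e0; exists y; split => //; apply: eU.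
by rewrite -ball_normE /= nrmE ltcE /= e'0 eqxx.
Qed.

Lemma closure_limit (A : set H) x : closure A x ->
  forall e : R, 0 < e -> exists2 y, A y & nrm (x - y) < e.
Proof.
move=> cA e e0.
have [|y [Ay xy]] := cA (ball x e%:C).
  by apply: nbhsx_ballx; rewrite ltcR.
exists y => //; move: xy; rewrite -ball_normE /= nrmE ltcR //.
Qed.

Lemma dense_limit (A : set H) x : dense A ->
  forall e : R, 0 < e -> exists2 y, A y & nrm (x - y) < e.
Proof.
move=> dA e e0.
have [|y [xy Ay]] := dA (ball x e%:C) _ (ball_open x e%:C).
  by exists x; apply: ballxx; rewrite ltcR.
by exists y => //; move: xy; rewrite -ball_normE /= nrmE ltcR.
Qed.

Lemma cauchy_limit (f : nat -> H) :
  (forall e : R, 0 < e -> exists N, forall m n, (N <= m)%N -> (N <= n)%N ->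
    nrm (f m - f n) <= e) ->
  exists l, forall e : R, 0 < e -> exists N, forall n, (N <= n)%N ->
    nrm (l - f n) <= e.
Proof.
move=> cf.
have : cauchy (f @ \oo).
  apply/cauchy_ballP => -[e e'] /= ; rewrite ltcE /= => /andP[/eqP e'0 e0].
  have [|N hN] := cf (e / 2); first by rewrite divr_gt0.
  near=> p; rewrite -ball_normE /= nrmE.
  have : exists m n, [/\ (N <= m)%N, (N <= n)%N & p = (f m, f n)].
    near: p.
    exists (f @` [set n | (N <= n)%N], f @` [set n | (N <= n)%N]).
      by split; exists N => // n /= Nn; exists n.
    by move=> [p q] /= [[m Nm <-] [n Nn <-]]; exists m, n.
  move=> [m [n [Nm Nn ->]]] /=; rewrite ltcE /= e'0 eqxx /=.
  apply: le_lt_trans (hN _ _ Nm Nn) _; rewrite ltr_pdivrMr // ltr_pMr // ltr1n //.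
move=> /cauchy_cvgP /cvg_ex[l /cvgrPdist_lt hl]; exists l => e e0.
have [|N _ hN] := hl e%:C; first by rewrite ltcR.
by exists N => n Nn; apply: ltW; move: (hN n Nn); rewrite nrmE ltcR.
Unshelve. all: by end_near.
Qed.

End HilbertSpace.

Lemma natS_gt (R : realType) (t : R) : exists n, t < n.+1%:R.
Proof.
exists (Num.Def.archi_bound `|t|); apply: le_lt_trans (ler_norm t) _.
by apply: lt_trans (archi_boundP (normr_ge0 t)) _; rewrite ltr_nat.
Qed.

(** * Subspaces and orthogonal projection *)

Section Subspaces.
Variables (R : realType) (V : lmodType R[i]) (K : set V).
Hypothesis K_lin : linear_subspace K.

Lemma subspace0 : K 0.
Proof. by have [/set_mem] := K_lin. Qed.

Lemma subspaceZD a x y : K x -> K y -> K (a *: x + y).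
Proof.
by move=> Kx Ky; have [_ h] := K_lin; apply/set_mem/h; exact/mem_set.
Qed.

Lemma subspaceZ a x : K x -> K (a *: x).
Proof.
by move=> Kx; rewrite -[_ *: _]addr0; apply: subspaceZD => //; exact: subspace0.
Qed.

Lemma subspaceD x y : K x -> K y -> K (x + y).
Proof. by move=> Kx Ky; rewrite -[x]scale1r; apply: subspaceZD. Qed.

Lemma subspaceN x : K x -> K (- x).
Proof. by move=> Kx; rewrite -scaleN1r; apply: subspaceZ. Qed.

Lemma subspaceB x y : K x -> K y -> K (x - y).
Proof. by move=> Kx Ky; apply: subspaceD => //; apply: subspaceN. Qed.

End Subspaces.

Lemma subspaceP (R : realType) (V : lmodType R[i]) (K : set V) :
  K 0 -> (forall a x y, K x -> K y -> K (a *: x + y)) -> linear_subspace K.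
Proof.
move=> K0 KZD; split; first exact/mem_set.
by move=> a x y /set_mem Kx /set_mem Ky; apply/mem_set/KZD.
Qed.

Section Span.
Variables (R : realType) (V : lmodType R[i]) (A : set V).

Lemma span_subspace : linear_subspace (linear_span A).
Proof.
apply: subspaceP => [K [/subspace0 //]|a x y hx hy K [Klin AK]].
by apply: subspaceZD => //; [exact: hx | exact: hy].
Qed.

Lemma sub_span : A `<=` linear_span A.
Proof. by move=> x Ax K [_]; apply. Qed.

Lemma span_sub (K : set V) : linear_subspace K -> A `<=` K -> linear_span A `<=` K.
Proof. by move=> Klin AK x; apply. Qed.

End Span.

Section Projection.
Variables (R : realType) (H : completeNormedModType R[i]).
Variable dot : {dot H for Num.conj}.
Hypothesis dot_norm : induces_norm dot.
Implicit Types (x y w : H) (a : R[i]) (K : set H).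

Lemma closure_subspace K : linear_subspace K -> linear_subspace (closure K).
Proof.
move=> Klin; apply: subspaceP => [|a x y cx cy].
  by apply: subset_closure; exact: subspace0.
apply: (closed_limit (@closed_closure _ K)) => e e0.
have c0 : 0 < cabs a + 1 by rewrite ltr_wpDl ?cabs_ge0.
have [x' Kx' xx'] := closure_limit cx (divr_gt0 e0 (mulr_gt0 (ltr0n _ 2) c0)).
have [y' Ky' yy'] := closure_limit cy (divr_gt0 e0 (ltr0n _ 2)).
exists (a *: x' + y'); first by apply: subset_closure; exact: subspaceZD.
rewrite opprD addrACA -scalerBr; apply: le_lt_trans (nrmD _ _) _.
rewrite nrmZ [ltRHS]splitr; apply: ler_ltD => //.
apply: (@le_trans _ _ ((cabs a + 1) * nrm (x - x'))).
  by rewrite ler_wpM2r ?nrm_ge0 // lerDl.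
rewrite mulrC -ler_pdivlMr //; apply: le_trans (ltW xx') _.
by rewrite invfM mulrA.
Qed.

(** Moving y by the multiple a k of k, with a = (w, k) / |k|^2, would bring it
    closer to x by |(w, k)|^2 / |k|^2. *)
Lemma nearest_orthogonal K x y : linear_subspace K -> K y ->
  (forall k, K k -> nrm (x - y) ^+ 2 <= nrm (x - k) ^+ 2) ->
  forall k, K k -> dot (x - y) k = 0.
Proof.
move=> Klin Ky near k Kk; set w := x - y; set c := dot w k.
apply/eqP; rewrite -cabs_eq0; apply/eqP/le_anti; rewrite cabs_ge0 andbT leNgt.
apply/negP => c0.
have nk0 : 0 < nrm k.
  rewrite nrm_gt0; apply/eqP => k0; move: c0.
  by rewrite /c k0 dot0r cabs0 ltxx.
have k0 : 0 < nrm k ^+ 2 by rewrite exprn_gt0.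
have nk : nrm k != 0 by rewrite gt_eqF.
pose a : R[i] := (nrm k ^- 2)%:C * c.
have := near _ (subspaceD Klin Ky (subspaceZ Klin a Kk)).
rewrite (_ : x - (_ + _) = w - a *: k) ?opprD ?addrA // -/w (nrm_sqrB dot_norm w) => h0.
have {h0} : 2 * complex.Re (dot w (a *: k)) <= nrm (a *: k) ^+ 2 by lra.
rewrite nrmZ dotZr -/c.
have -> : complex.Re (Num.conj a * c) = nrm k ^- 2 * cabs c ^+ 2.
  by rewrite /a !ReImE /= cabs_sqr; ring.
have p0 : 0 < nrm k ^- 2 * cabs c ^+ 2 by rewrite mulr_gt0 ?invr_gt0 // exprn_gt0.
rewrite cabsM cabs_real ger0_norm ?invr_ge0 ?sqr_ge0 //.
have -> : (nrm k ^- 2 * cabs c * nrm k) ^+ 2 = nrm k ^- 2 * cabs c ^+ 2.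
  by field.
lra.
Qed.

(** By the parallelogram identity a minimizing sequence for the distance from
    x to K is Cauchy, because the midpoints of its terms lie in K as well. *)
Lemma projection K x : linear_subspace K -> closed K ->
  exists2 y, K y & forall k, K k -> dot (x - y) k = 0.
Proof.
move=> Klin Kcl.
pose D := [set nrm (x - k) ^+ 2 | k in K].
have D0 : lbound D 0 by move=> _ [k _ <-]; rewrite sqr_ge0.
have Dinf : has_inf D.
  by split; [exists (nrm (x - 0) ^+ 2), 0 => //; exact: subspace0 | exists 0].
set d := inf D.
have dle k : K k -> d <= nrm (x - k) ^+ 2.
  by move=> Kk; apply: ge_inf; [case: Dinf | exists k].
have ex n : exists k, K k /\ nrm (x - k) ^+ 2 < d + n.+1%:R^-1.
  have [|_ [k Kk <-] hk] := @inf_adherent _ D n.+1%:R^-1 _ Dinf; first by [].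
  by exists k.
have {ex}[f hf] := choice ex.
have fK n : K (f n) by case: (hf n).
have cauchy m n N : (N <= m)%N -> (N <= n)%N ->
    nrm (f m - f n) ^+ 2 <= 4 * N.+1%:R^-1.
  move=> Nm Nn.
  have hm k : (N <= k)%N -> nrm (x - f k) ^+ 2 <= d + N.+1%:R^-1.
    move=> Nk; apply: le_trans (ltW (hf k).2) _; rewrite lerD2l lef_pV2 ?posrE //.
    by rewrite ler_nat.
  have := parallelogram dot_norm (x - f n) (x - f m).
  have -> : x - f n - (x - f m) = f m - f n by lincomb R[i]; ring.
  have -> : x - f n + (x - f m) = 2 *: (x - 2^-1 *: (f m + f n)).
    by lincomb R[i]; field.
  rewrite nrmZ exprMn (_ : cabs 2 = 2); last first.
    by rewrite -(rmorph_nat (real_complex R)) cabs_real ger0_norm.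
  have := dle _ (subspaceZ Klin 2^-1 (subspaceD Klin (fK m) (fK n))).
  move: (hm _ Nm) (hm _ Nn); move: (N.+1%:R^-1) => t h1 h2 h3 h4.
  lra.
have [l hl] : exists l, forall e : R, 0 < e -> exists N, forall n, (N <= n)%N ->
    nrm (l - f n) <= e.
  apply: cauchy_limit => e e0.
  have [N hN] := natS_gt (4 / e ^+ 2).
  exists N => m n Nm Nn.
  rewrite -(ler_pXn2r (n := 2)) ?nnegrE ?nrm_ge0 ?ltW //.
  apply: le_lt_trans (cauchy _ _ _ Nm Nn) _.
  by rewrite ltr_pdivrMr // mulrC -ltr_pdivrMr // exprn_gt0.
have Kl : K l.
  apply: closed_limit => // e e0.
  have [N hN] := hl (e / 2) (divr_gt0 e0 (ltr0n _ 2)); exists (f N) => //.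
  by apply: le_lt_trans (hN N (leqnn _)) _; rewrite ltr_pdivrMr // ltr_pMr // ltr1n.
exists l => //; apply: nearest_orthogonal => // k Kk.
rewrite ler_pXn2r ?nnegrE ?nrm_ge0 //; apply/ler_addgt0Pr => e e0.
have [N hN] := hl (e / 2) (divr_gt0 e0 (ltr0n _ 2)).
have [M hM] := natS_gt ((2 / e) ^+ 2).
set n := maxn N M.
apply: le_trans (nrm_triB x (f n) l) _.
have h1 : nrm (f n - l) <= e / 2 by rewrite nrmB hN // leq_maxl.
have h2 : nrm (x - f n) <= nrm (x - k) + e / 2.
  rewrite -(ler_pXn2r (n := 2)) ?nnegrE ?addr_ge0 ?nrm_ge0 ?divr_ge0 ?(ltW e0) //.
  apply: le_trans (ltW (hf n).2) _; rewrite sqrrD.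
  apply: (@le_trans _ _ (nrm (x - k) ^+ 2 + (e / 2) ^+ 2)).
    apply: lerD; first exact: dle.
    rewrite -[leRHS]invrK lef_pV2 ?posrE ?invr_gt0 ?exprn_gt0 ?divr_gt0 //.
    rewrite -exprVn invf_div; apply: ltW; apply: lt_le_trans hM _.
    by rewrite ler_nat ltnS leq_maxr.
  by rewrite lerD2r lerDl mulrn_wge0 // mulr_ge0 ?nrm_ge0 // divr_ge0 // ltW.
lra.
Qed.

(** The form in which projections are used: surjectivity of an operator with
    closed range becomes a uniqueness question for the adjoint equation. *)
Lemma closed_subspace_full K : linear_subspace K -> closed K ->
  (forall w, (forall k, K k -> dot w k = 0) -> w = 0) -> forall x, K x.
Proof.
move=> Klin Kcl h x; have [y Ky xy] := projection x Klin Kcl.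
by move/h: xy => /eqP; rewrite subr_eq0 => /eqP ->.
Qed.

End Projection.

(** * Isometries and approximate spectral projections on the circle *)

Section RootsOfUnity.
Variable R : realType.

Lemma primitive_root_exists m : (0 < m)%N -> exists w : R[i], m.-primitive_root w.
Proof.
move=> m0; pose p : {poly R[i]} := ('X^m - 1)%R.
have [r] := closed_field_poly_normal p.
rewrite (monicP _) ?monicXnsubC // scale1r => Dp.
have rm1 : all m.-unity_root r by apply/allP=> z; rewrite -root_prod_XsubC -Dp.
have sz_r : (m < (size r).+1)%N.
  by rewrite -(size_prod_XsubC r id) -Dp size_XnsubC.
have [|z _ zm] := hasP (has_prim_root m0 rm1 _ sz_r); last by exists z.
by rewrite -separable_prod_XsubC -Dp separable_Xn_sub_1 // pnatr_eq0 -lt0n.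
Qed.

Variables (m : nat) (w : R[i]).
Hypothesis w_prim : m.-primitive_root w.

Let m0 : (0 < m)%N. Proof. exact: prim_order_gt0 w_prim. Qed.

Lemma root_neq0 : w != 0.
Proof.
apply/eqP => w0; have /eqP := prim_expr_order w_prim.
by rewrite w0 expr0n (gtn_eqF m0) eq_sym oner_eq0.
Qed.

Lemma cabs_root : cabs w = 1.
Proof.
apply/eqP; rewrite -(pexpr_eq1 m0 (cabs_ge0 _)) -cabsX (prim_expr_order w_prim).
by rewrite cabs1.
Qed.

Lemma conj_root : Num.conj w = w^-1.
Proof.
apply: (mulfI root_neq0); rewrite divff ?root_neq0 //.
have cw := cabs_sqr w; rewrite cabs_root expr1n in cw.
by apply: complex_ext; rewrite ?ReImE /= ?[RHS]cw; ring.
Qed.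

Lemma sum_root_powers k l : (k < m)%N -> (l < m)%N ->
  \sum_(j < m) (w^-1 ^+ (j * k) * w ^+ (j * l)) = if k == l then m%:R else 0.
Proof.
move=> km lm; set e := w^-1 ^+ k * w ^+ l.
have -> : \sum_(j < m) (w^-1 ^+ (j * k) * w ^+ (j * l)) = \sum_(j < m) e ^+ j.
  by apply: eq_bigr => j _; rewrite /e exprMn -!exprM !(mulnC j).
have [kl|kl] := eqVneq k l.
  rewrite (eq_bigr (fun=> 1)) => [|j _]; first by rewrite sumr_const card_ord.
  by rewrite /e kl -exprMn mulVf ?root_neq0 // !expr1n.
have e1 : e != 1.
  apply: contraNneq kl => /(congr1 ( *%R (w ^+ k))).
  rewrite /e mulrA -exprMn divff ?root_neq0 // expr1n mul1r mulr1.
  move/eqP; rewrite (eq_prim_root_expr w_prim) !modn_small // eq_sym //.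
have em : e ^+ m = 1.
  rewrite /e exprMn -!exprM !(mulnC _ m) !exprM exprVn.
  by rewrite (prim_expr_order w_prim) invr1 !expr1n mulr1.
apply/eqP; have /eqP := subrX1 e m; rewrite em subrr eq_sym mulf_eq0.
by rewrite subr_eq0 (negbTE e1).
Qed.

End RootsOfUnity.

Section Isometry.
Variables (R : realType) (H : completeNormedModType R[i]).
Variable dot : {dot H for Num.conj}.
Hypothesis dot_norm : induces_norm dot.
Variable U : H -> H.
Hypothesis U_lin : forall (a : R[i]) x y, U (a *: x + y) = a *: U x + U y.
Hypothesis U_iso : forall x, nrm (U x) = nrm x.
Implicit Types (x y v : H) (a g : R[i]).

Lemma iter_lin k a x y :
  iter k U (a *: x + y) = a *: iter k U x + iter k U y.
Proof. by elim: k => //= k ->; rewrite U_lin. Qed.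

Lemma iter_iso k x : nrm (iter k U x) = nrm x.
Proof. by elim: k => //= k IH; rewrite U_iso. Qed.

Section Averages.
Variables (m : nat) (w : R[i]).
Hypothesis w_prim : m.-primitive_root w.

Let m0 : (0 < m)%N. Proof. exact: prim_order_gt0 w_prim. Qed.
Let mC0 : (m%:R : R[i]) != 0. Proof. by rewrite pnatr_eq0 -lt0n. Qed.
Let w0 : w != 0. Proof. exact: root_neq0 w_prim. Qed.
Let w1 : cabs w = 1. Proof. exact: cabs_root w_prim. Qed.

(** The discrete Fourier transform of the orbit of x under U. For a unitary U
    this is the function (1/m) (1 + s + ... + s^(m-1)) of U / w^j, a kernel
    concentrated on an arc of length about 1/m around w^j; it stands in for the
    spectral projection of that arc. *)
Definition spec_avg (j : nat) x : H :=
  m%:R^-1 *: \sum_(k < m) w^-1 ^+ (j * k) *: iter k U x.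

Lemma spec_avg_lin j a x y :
  spec_avg j (a *: x + y) = a *: spec_avg j x + spec_avg j y.
Proof.
rewrite /spec_avg scalerA [a * _]mulrC -scalerA -scalerDr; congr (_ *: _).
rewrite scaler_sumr -big_split; apply: eq_bigr => k _ /=.
by rewrite iter_lin; lincomb R[i]; ring.
Qed.

(** The geometric sum telescopes, so that the averages are eigenvectors of U
    for w^j up to an error of order 1/m. *)
Lemma spec_avg_shift j x :
  spec_avg j (U x) - w ^+ j *: spec_avg j x =
  (w ^+ j / m%:R) *: (iter m U x - x).
Proof.
pose F k := w^-1 ^+ (j * k) *: iter k U x.
have -> : spec_avg j (U x) = (w ^+ j / m%:R) *: \sum_(k < m) F k.+1.
  rewrite /spec_avg -scalerA scalerA mulrC -scalerA; congr (_ *: _).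
  rewrite scaler_sumr; apply: eq_bigr => k _; rewrite /F -iterSr scalerA.
  by rewrite mulnS exprD mulrA -exprMn divff // expr1n mul1r.
have -> : w ^+ j *: spec_avg j x = (w ^+ j / m%:R) *: \sum_(k < m) F k.
  by rewrite /spec_avg scalerA.
rewrite -scalerBr; congr (_ *: _).
have e1 : \sum_(k < m.+1) F k = F 0%N + \sum_(k < m) F k.+1 by rewrite big_ord_recl.
have e2 : \sum_(k < m.+1) F k = \sum_(k < m) F k + F m by rewrite big_ord_recr.
have F0 : F 0%N = x by rewrite /F muln0 expr0 scale1r.
have Fm : F m = iter m U x.
  by rewrite /F mulnC exprM exprVn (prim_expr_order w_prim) invr1 expr1n scale1r.
rewrite -Fm -[X in _ = _ - X]F0; apply/eqP; rewrite -subr_eq0; apply/eqP.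
move: e1; rewrite e2 => /eqP; rewrite -subr_eq0 => /eqP h.
by rewrite -[RHS]oppr0 -[in RHS]h; lincomb R[i]; ring.
Qed.

Lemma spec_avg_shift_le j x :
  nrm (spec_avg j (U x) - w ^+ j *: spec_avg j x) <= 2 * nrm x / m%:R.
Proof.
rewrite spec_avg_shift nrmZ cabsM cabsX w1 expr1n mul1r cabsV.
rewrite -(rmorph_nat (real_complex R)) cabs_real ger0_norm // mulrC.
rewrite ler_pM2r ?invr_gt0 ?ltr0n //; apply: le_trans (nrmD _ _) _.
by rewrite nrmN iter_iso; lra.
Qed.

Lemma dot_sumr (I : Type) (r : seq I) (P : pred I) (F : I -> H) x :
  dot x (\sum_(i <- r | P i) F i) = \sum_(i <- r | P i) dot x (F i).
Proof.
by elim/big_rec2: _ => [|i y z _ <-]; rewrite ?dot0r // dotDr.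
Qed.

Lemma dot_suml (I : Type) (r : seq I) (P : pred I) (F : I -> H) x :
  dot (\sum_(i <- r | P i) F i) x = \sum_(i <- r | P i) dot (F i) x.
Proof.
by elim/big_rec2: _ => [|i y z _ <-]; rewrite ?dot0l // dotDl.
Qed.

(** Orthogonality of the characters of Z/m leaves the diagonal terms
    |U^k x|^2 = |x|^2, so that the averages resolve the identity exactly. *)
Lemma spec_avg_parseval x :
  \sum_(j < m) nrm (spec_avg j x) ^+ 2 = nrm x ^+ 2.
Proof.
apply: (@complexI R); rewrite rmorph_sum /=.
pose D (k l : 'I_m) := dot (iter k U x) (iter l U x).
have Ej (j : 'I_m) : (nrm (spec_avg j x) ^+ 2)%:C = m%:R^-2 *
    \sum_(k < m) \sum_(l < m) (w^-1 ^+ (j * k) * w ^+ (j * l)) * D k l.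
  rewrite -(dotxx dot_norm) /spec_avg dotZl dotZr mulrA fmorphV rmorph_nat.
  rewrite -expr2 exprVn.
  congr (_ * _); rewrite dot_suml; apply: eq_bigr => k _.
  rewrite dot_sumr; apply: eq_bigr => l _; rewrite dotZl dotZr mulrA /D.
  by rewrite rmorphXn fmorphV /= (conj_root w_prim) invrK.
rewrite (eq_bigr _ (fun j _ => Ej j)) -mulr_sumr exchange_big /=.
have row (k : 'I_m) : \sum_(j < m) \sum_(l < m)
    (w^-1 ^+ (j * k) * w ^+ (j * l)) * D k l = m%:R * (nrm x ^+ 2)%:C.
  rewrite exchange_big (bigD1 k) //= [X in _ + X]big1 => [|l lk].
    rewrite -mulr_suml (sum_root_powers w_prim) // eqxx addr0 /D.
    by rewrite (dotxx dot_norm) iter_iso.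
  by rewrite -mulr_suml (sum_root_powers w_prim) // ifN ?mul0r // eq_sym.
rewrite (eq_bigr _ (fun k _ => row k)).
rewrite sumr_const card_ord -mulr_natr; move: mC0; set M := m%:R => M0.
by field.
Qed.

End Averages.

(** If (U - z) x = v has solutions of norm at most N for all z on the arc, then
    each average of v at a point w^j of the arc is (U - w^j) applied to an
    average, hence of norm O(N / m); the squares of the at most m such norms
    add up to O(N^2 / m). As m grows all of v is therefore carried by the
    averages at points at distance at least r from g, where U - g acts almost as
    multiplication by w^j - g. *)
Lemma arc_lower_bound g (r N : R) v : 0 <= r -> 0 <= N ->
  (forall z, cabs z = 1 -> cabs (z - g) < r ->
    exists2 x, U x - z *: x = v & nrm x <= N) ->
  r ^+ 2 * nrm v ^+ 2 <= 2 * nrm (U v - g *: v) ^+ 2.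
Proof.
move=> r0 N0 h.
pose C := 4 * N ^+ 2 * r ^+ 2 + 8 * nrm v ^+ 2.
suff hm m : (0 < m)%N ->
    r ^+ 2 * nrm v ^+ 2 <= 2 * nrm (U v - g *: v) ^+ 2 + C / m%:R.
  apply/ler_addgt0Pr => e e0; have [n hn] := natS_gt (C / e).
  apply: le_trans (hm n.+1 isT) _; rewrite lerD2l ler_pdivrMr ?ltr0n // mulrC.
  by rewrite -ler_pdivrMr // ltW.
move=> m0; have [w w_prim] := primitive_root_exists R m0.
have mR0 : (0 : R) < m%:R by rewrite ltr0n.
have avg_bound (j : 'I_m) : r ^+ 2 * nrm (spec_avg m w j v) ^+ 2 <=
    2 * nrm (spec_avg m w j (U v - g *: v)) ^+ 2 + C / m%:R ^+ 2.
  set b := nrm (spec_avg m w j v); set a := nrm _.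
  (* The first term of C pays for the points of the arc, the second one for the
     error of order 1/m at the other points. *)
  have b0 : 0 <= b by exact: nrm_ge0.
  have a0 : 0 <= a by exact: nrm_ge0.
  have Cm : C / m%:R ^+ 2 = (2 * N / m%:R) ^+ 2 * r ^+ 2 + 2 * (2 * nrm v / m%:R) ^+ 2.
    by rewrite /C; field; rewrite gt_eqF.
  have [lt|ge] := ltP (cabs (w ^+ j - g)) r.
    have [|x xv xN] := h (w ^+ j) _ lt.
      by rewrite cabsX (cabs_root w_prim) expr1n.
    have : b <= 2 * N / m%:R.
      apply: (@le_trans _ _ (2 * nrm x / m%:R)); last first.
        by rewrite ler_pM2r ?invr_gt0 // ler_pM2l.
      apply: le_trans (spec_avg_shift_le w_prim j x); rewrite /b -xv.
      rewrite [X in spec_avg m w j X]addrC -scaleNr spec_avg_lin.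
      by rewrite addrC scaleNr.
    move=> bN; rewrite Cm mulrC.
    have {bN} : b ^+ 2 <= (2 * N / m%:R) ^+ 2.
      by rewrite ler_pXn2r ?nnegrE // ?divr_ge0 ?mulr_ge0 // ltW.
    move/(ler_wpM2r (sqr_ge0 r)) => le1; apply: le_trans le1 _.
    have := sqr_ge0 a; have := sqr_ge0 (2 * nrm v / m%:R); lra.
  have : r * b <= a + 2 * nrm v / m%:R.
    apply: (@le_trans _ _ (cabs (w ^+ j - g) * b)); first exact: ler_wpM2r.
    rewrite /b -nrmZ.
    have -> : (w ^+ j - g) *: spec_avg m w j v =
        spec_avg m w j (U v - g *: v) -
        (spec_avg m w j (U v) - w ^+ j *: spec_avg m w j v).
      rewrite (addrC (U v) (- (g *: v))) -scaleNr spec_avg_lin.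
      by lincomb R[i]; ring.
    apply: le_trans (nrmD _ _) _; rewrite nrmN lerD2l.
    exact: spec_avg_shift_le.
  set t := 2 * nrm v / m%:R in Cm *.
  move=> rb; have t0 : 0 <= t by rewrite divr_ge0 ?mulr_ge0 ?nrm_ge0 // ltW.
  have : (r * b) ^+ 2 <= (a + t) ^+ 2.
    by rewrite ler_pXn2r ?nnegrE // ?mulr_ge0 ?addr_ge0.
  rewrite exprMn => h1; rewrite Cm.
  have := sqr_ge0 (a - t); have := mulr_ge0 (sqr_ge0 (2 * N / m%:R)) (sqr_ge0 r).
  move=> h2 h3; nra.
have : \sum_(j < m) r ^+ 2 * nrm (spec_avg m w j v) ^+ 2 <=
    \sum_(j < m) (2 * nrm (spec_avg m w j (U v - g *: v)) ^+ 2 + C / m%:R ^+ 2).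
  by apply: ler_sum => j _; exact: avg_bound.
rewrite -mulr_sumr (spec_avg_parseval w_prim) big_split /= -mulr_sumr.
rewrite (spec_avg_parseval w_prim) sumr_const card_ord.
have -> // : C / m%:R ^+ 2 *+ m = C / m%:R.
by rewrite -[LHS]mulr_natr; field; rewrite gt_eqF.
Qed.

End Isometry.

(** * Self-adjoint operators and their resolvents *)

Section SelfAdjoint.
Variables (R : realType) (H : completeNormedModType R[i]).
Variable dot : {dot H for Num.conj}.
Hypothesis dot_norm : induces_norm dot.

(** For a densely defined symmetric operator, being equal to its adjoint amounts
    to the surjectivity of T - z off the real axis; T (x, v + z *: x) reads
    (T - z) x = v. *)
Record self_adjoint (T : set (H * H)) : Prop := SelfAdjoint {
  sa_subspace : linear_subspace T;
  sa_symmetric : symmetric_operator dot T;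
  sa_dense : dense (domain T);
  sa_onto : forall z : R[i], complex.Im z != 0 -> forall v, exists x, T (x, v + z *: x)
}.

Section Symmetric.
Variable T : set (H * H).
Hypothesis T_lin : linear_subspace T.
Hypothesis T_sym : symmetric_operator dot T.
Implicit Types (x y v w : H) (z a : R[i]) (t e : R).

Lemma opZD a x y x' y' : T (x, y) -> T (x', y') -> T (a *: x + x', a *: y + y').
Proof. by move=> h h'; exact: (subspaceZD T_lin a h h'). Qed.

Lemma opD x y x' y' : T (x, y) -> T (x', y') -> T (x + x', y + y').
Proof. by move=> h h'; exact: (subspaceD T_lin h h'). Qed.

Lemma opB x y x' y' : T (x, y) -> T (x', y') -> T (x - x', y - y').
Proof. by move=> h h'; exact: (subspaceB T_lin h h'). Qed.

Lemma opZ a x y : T (x, y) -> T (a *: x, a *: y).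
Proof. by move=> h; exact: (subspaceZ T_lin a h). Qed.

Lemma Im_dot_symmetric x y : T (x, y) -> complex.Im (dot y x) = 0.
Proof.
move=> Txy; have := T_sym Txy Txy; rewrite (dotC dot x y) => /(congr1 (@complex.Im R)).
rewrite Im_conjc; lra.
Qed.

(** For real t the operator T - t is symmetric, so (T - t) x and i x are
    orthogonal for the real inner product. Every estimate off the real axis
    comes from this identity. *)
Lemma nrm_shift_sqr x y t e : T (x, y) ->
  nrm (y - (t +i* e) *: x) ^+ 2 = nrm (y - t%:C *: x) ^+ 2 + e ^+ 2 * nrm x ^+ 2.
Proof.
move=> Txy; have Imyx := Im_dot_symmetric Txy.
have -> : y - (t +i* e) *: x = (y - t%:C *: x) - (0 +i* e) *: x.
  have -> : t +i* e = t%:C + (0 +i* e).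
    by apply: complex_ext => /=; rewrite ?addr0 ?add0r.
  by lincomb R[i]; ring.
rewrite (nrm_sqrB dot_norm) nrmZ exprMn cabs_sqr /= expr0n /= add0r.
rewrite dotZr dotDl dotNl dotZl !ReImE /= Imyx (Im_dotxx dot_norm); ring.
Qed.

Lemma nrm_shift x y t e : T (x, y) ->
  nrm (y - (t +i* e) *: x) = nrm (y - (t -i* e) *: x).
Proof.
move=> Txy; apply/eqP; rewrite -(eqrXn2 (n := 2)) ?nrm_ge0 //.
by rewrite (nrm_shift_sqr t e Txy) (nrm_shift_sqr t (- e) Txy) sqrrN.
Qed.

Lemma nonreal_lower_bound z x v : T (x, v + z *: x) ->
  `|complex.Im z| * nrm x <= nrm v.
Proof.
move=> Txv; rewrite -(ler_pXn2r (n := 2)) ?nnegrE ?mulr_ge0 ?nrm_ge0 //.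
have := nrm_shift_sqr (complex.Re z) (complex.Im z) Txv.
have -> : complex.Re z +i* complex.Im z = z by case: (z).
rewrite addrK => ->; rewrite exprMn real_normK ?num_real //.
by rewrite lerDr sqr_ge0.
Qed.

Lemma nonreal_eigenvector z x : complex.Im z != 0 -> T (x, z *: x) -> x = 0.
Proof.
move=> z0 Tx; apply: nrm_le0; have := @nonreal_lower_bound z x 0.
by rewrite add0r nrm0 => /(_ Tx); rewrite pmulr_rle0 ?normr_gt0.
Qed.

(** The product topology is replaced by approximation of both components in the
    real-valued norm. *)
Definition graph_closed : Prop := forall x y,
  (forall e, 0 < e -> exists2 p, T p & nrm (x - p.1) < e /\ nrm (y - p.2) < e) ->
  T (x, y).

Lemma closed_graph_closed : closed_operator T -> graph_closed.
Proof.
move=> Tcl x y h; rewrite (_ : T = closure T); last by rewrite -(closure_id T).1.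
move=> U /nbhs_ballP[[e e'] /= e0 eU].
move: e0; rewrite ltcE /= => /andP[/eqP e'0 e0].
have [[x' y'] Tp /= [xx' yy']] := h e e0; exists (x', y'); split => //; apply: eU.
by split; rewrite -ball_normE /= nrmE ltcE /= e'0 eqxx.
Qed.

(** If (x, y) is a limit of points of T, the solution x0 of
    (T - z) x0 = y - z x must be x, since (T - z)^-1 is bounded. *)
Lemma symmetric_onto_closed z : complex.Im z != 0 ->
  (forall v, exists x, T (x, v + z *: x)) -> graph_closed.
Proof.
move=> z0 onto x y h; have [x0 Tx0] := onto (y - z *: x).
suff xx0 : x = x0.
  by move: Tx0; rewrite -xx0 subrK.
apply/eqP; rewrite -subr_eq0; apply/eqP/nrm_le0/ler_addgt0Pr => e e0; rewrite add0r.
set k := `|complex.Im z|; have k0 : 0 < k by rewrite normr_gt0.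
have kz : k <= cabs z by exact: abs_Im_cabs.
have [|[x' y'] Tp /= [xx' yy']] := h (k * e / (2 * cabs z + 1)).
  by rewrite divr_gt0 ?mulr_gt0 //; lra.
have : T (x' - x0, (y' - y + z *: (x - x')) + z *: (x' - x0)).
  by have := opB Tp Tx0; congr T; congr pair; lincomb R[i]; ring.
move=> /nonreal_lower_bound; rewrite -/k => h1.
have h2 := nrmD (y' - y) (z *: (x - x')); rewrite nrmZ (nrmB y') in h2.
have h3 := nrm_triB x x' x0.
rewrite ltr_pdivlMr in xx'; last by lra.
rewrite ltr_pdivlMr in yy'; last by lra.
have nx := nrm_ge0 (x - x'); have ny := nrm_ge0 (y - y').
rewrite -(ler_pM2l k0); apply: (@le_trans _ _ (k * nrm (x - x') + k * nrm (x' - x0))).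
  by rewrite -mulrDr ler_wpM2l // ltW.
have h4 : k * nrm (x - x') <= cabs z * nrm (x - x') by rewrite ler_wpM2r.
have c0 : 0 <= cabs z := cabs_ge0 z.
have c1 : 0 < 2 * cabs z + 1 by lra.
have h5 : k * nrm (x - x') + k * nrm (x' - x0) <=
  nrm (y - y') + 2 * cabs z * nrm (x - x') by lra.
apply: le_trans h5 _; rewrite -(ler_pM2r c1).
have h6 : nrm (y - y') * (2 * cabs z + 1) <= k * e by exact: ltW.
have h7 : 2 * cabs z * (nrm (x - x') * (2 * cabs z + 1)) <= 2 * cabs z * (k * e).
  by rewrite ler_wpM2l ?mulr_ge0 // ltW.
lra.
Qed.

(** The lower bound makes convergence of (T - z) x_n force that of x_n. *)
Lemma closed_range z : complex.Im z != 0 -> graph_closed ->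
  closed [set v | exists x, T (x, v + z *: x)].
Proof.
move=> z0 Tcl v cv; set k := `|complex.Im z|.
have k0 : 0 < k by rewrite normr_gt0.
have ex n : exists p, T (p.1, p.2 + z *: p.1) /\ nrm (v - p.2) < n.+1%:R^-1.
  have [|v' [x Tx] vv'] := closure_limit cv (e := n.+1%:R^-1); first by [].
  by exists (x, v').
have [f hf] := choice ex.
have [x hx] : exists x, forall e, 0 < e -> exists N, forall n, (N <= n)%N ->
    nrm (x - (f n).1) <= e.
  apply: cauchy_limit => e e0; have [N hN] := natS_gt (2 / (k * e)).
  have ke : 0 < k * e by rewrite mulr_gt0.
  have hN' : 2 * N.+1%:R^-1 < k * e.
    by rewrite ltr_pdivrMr // mulrC -ltr_pdivrMr.
  exists N => m n Nm Nn; have [Tm vm] := hf m; have [Tn vn] := hf n.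
  have hI p : (N <= p)%N -> p.+1%:R^-1 <= N.+1%:R^-1 :> R.
    by move=> Np; rewrite lef_pV2 ?posrE // ler_nat.
  have : T ((f m).1 - (f n).1, ((f m).2 - (f n).2) + z *: ((f m).1 - (f n).1)).
    by have := opB Tm Tn; congr T; congr pair; lincomb R[i]; ring.
  move=> /nonreal_lower_bound; rewrite -/k => h1.
  have h2 := nrm_triB (f m).2 v (f n).2; rewrite (nrmB (f m).2 v) in h2.
  have := hI m Nm; have := hI n Nn; move: vm vn hN'.
  move: m.+1%:R^-1 n.+1%:R^-1 N.+1%:R^-1 => a b c h3 h4 h5 h6 h7.
  by rewrite -(ler_pM2l k0); lra.
exists x; apply: Tcl => e e0.
have c0 : 0 < cabs z + 1 by rewrite ltr_wpDl ?cabs_ge0.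
set t := e / (2 * (cabs z + 1)).
have t0 : 0 < t by rewrite divr_gt0 // mulr_gt0.
have te : t * (2 * (cabs z + 1)) = e by rewrite /t mulfVK // gt_eqF // mulr_gt0.
have tz : 0 <= t * cabs z by rewrite mulr_ge0 ?cabs_ge0 // ltW.
have [N hN] := hx t t0; have [N' hN'] := natS_gt t^-1.
have [Tn vn] := hf (maxn N N'); set n := maxn N N' in Tn vn.
have h1 := hN n (leq_maxl _ _).
have h2 : nrm (v - (f n).2) < t.
  apply: lt_le_trans vn _; rewrite -[leRHS]invrK lef_pV2 ?posrE ?invr_gt0 //.
  by apply: ltW; apply: lt_le_trans hN' _; rewrite ler_nat ltnS leq_maxr.
exists ((f n).1, (f n).2 + z *: (f n).1) => //=; split; first lra.
have -> : v + z *: x - ((f n).2 + z *: (f n).1) = (v - (f n).2) + z *: (x - (f n).1).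
  by lincomb R[i]; ring.
have h3 := nrmD (v - (f n).2) (z *: (x - (f n).1)); rewrite nrmZ in h3.
have h4 : cabs z * nrm (x - (f n).1) <= cabs z * t by rewrite ler_wpM2l ?cabs_ge0.
lra.
Qed.

End Symmetric.

Section Resolvent.
Variable T : set (H * H).
Hypothesis T_sa : self_adjoint T.
Implicit Types (x y v w : H) (z a : R[i]) (t e : R).

Let T_lin := sa_subspace T_sa.
Let T_sym := sa_symmetric T_sa.

Lemma nonreal_inj z x x' v : complex.Im z != 0 ->
  T (x, v + z *: x) -> T (x', v + z *: x') -> x = x'.
Proof.
move=> z0 h h'; apply/eqP; rewrite -subr_eq0; apply/eqP.
apply: (nonreal_eigenvector T_sym z0); have := opB T_lin h h'.
by rewrite (_ : v + _ - _ = z *: (x - x')) //; lincomb R[i]; ring.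
Qed.

Lemma op_shiftP z w v : op_shift T z (w, v) <-> T (w, v + z *: w).
Proof.
split=> [[[x y] Txy [<- <-]]|Tw]; first by rewrite subrK.
by exists (w, v + z *: w) => //=; rewrite addrK.
Qed.

Lemma resolventP z v : complex.Im z != 0 ->
  T (resolvent T z v, v + z *: resolvent T z v).
Proof.
move=> z0; apply/op_shiftP; rewrite /resolvent; case: xgetP => [x _ //|].
by have [x /op_shiftP Tx] := sa_onto T_sa z0 v => /(_ x).
Qed.

Lemma resolventE z x v : complex.Im z != 0 -> T (x, v + z *: x) ->
  resolvent T z v = x.
Proof. by move=> z0 Tx; apply: nonreal_inj z0 (resolventP v z0) Tx. Qed.

Lemma resolvent_bound z v : complex.Im z != 0 ->
  `|complex.Im z| * nrm (resolvent T z v) <= nrm v.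
Proof. by move=> z0; apply: (nonreal_lower_bound T_sym); exact: resolventP. Qed.

Lemma resolvent_lin z a v w : complex.Im z != 0 ->
  resolvent T z (a *: v + w) = a *: resolvent T z v + resolvent T z w.
Proof.
move=> z0; apply: resolventE => //.
have := opZD T_lin a (resolventP v z0) (resolventP w z0).
by congr T; congr pair; lincomb R[i]; ring.
Qed.

Lemma resolvent0 z : complex.Im z != 0 -> resolvent T z 0 = 0.
Proof.
by move=> z0; apply: resolventE => //; rewrite scaler0 addr0; exact: subspace0 T_lin.
Qed.

Lemma resolventZ z a v : complex.Im z != 0 ->
  resolvent T z (a *: v) = a *: resolvent T z v.
Proof.
by move=> z0; rewrite -[a *: v]addr0 resolvent_lin // resolvent0 // addr0.
Qed.

Lemma resolventD z v w : complex.Im z != 0 ->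
  resolvent T z (v + w) = resolvent T z v + resolvent T z w.
Proof. by move=> z0; rewrite -[v in LHS]scale1r resolvent_lin // scale1r. Qed.

Lemma resolventB z v w : complex.Im z != 0 ->
  resolvent T z (v - w) = resolvent T z v - resolvent T z w.
Proof. by move=> z0; rewrite resolventD // -scaleN1r resolventZ // scaleN1r. Qed.

Lemma op_closed : graph_closed T.
Proof.
apply: (symmetric_onto_closed T_lin T_sym (z := - 'i%C)).
  by rewrite /= oppr_eq0 oner_eq0.
by move=> v; apply: (sa_onto T_sa); rewrite /= oppr_eq0 oner_eq0.
Qed.

(** As z goes to infinity along the imaginary axis, - z (T - z)^-1 tends
    strongly to the identity: on the domain of T the difference is
    - (T - z)^-1 T x, of norm at most |T x| / |z|, and the operators
    z (T - z)^-1 are contractions. *)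
Lemma resolvent_approx y e : 0 < e ->
  exists2 z : R[i], complex.Im z != 0 & nrm (- z *: resolvent T z y - y) < e.
Proof.
move=> e0; have e3 : 0 < e / 3 by rewrite divr_gt0.
have [x [[x1 w] /= Tx x1E] yx] := dense_limit y (sa_dense T_sa) e3.
rewrite {}x1E in Tx.
have [n hn] := natS_gt (nrm w / (e / 3)).
pose z : R[i] := 0 +i* n.+1%:R.
have n0 : (0 : R) < n.+1%:R by [].
have z0 : complex.Im z != 0 by rewrite /= gt_eqF.
exists z => //.
have h1 := resolvent_bound w z0; rewrite /= ger0_norm ?ler0n // in h1.
have h2 := resolvent_bound (y - x) z0; rewrite /= ger0_norm ?ler0n // in h2.
have Rx : - z *: resolvent T z x - x = - resolvent T z w.
  have : resolvent T z (w + - z *: x) = x.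
    by apply: resolventE => //; rewrite scaleNr subrK.
  rewrite resolventD // resolventZ // => h.
  by rewrite -[X in _ - X = _]h; lincomb R[i]; ring.
have -> : - z *: resolvent T z y - y =
    - z *: resolvent T z (y - x) - (y - x) - resolvent T z w.
  by rewrite resolventB // -[- resolvent T z w]Rx; lincomb R[i]; ring.
have h3 := nrmD (- z *: resolvent T z (y - x) - (y - x)) (- resolvent T z w).
have h4 := nrmD (- z *: resolvent T z (y - x)) (- (y - x)).
have h5 : nrm (- z *: resolvent T z (y - x)) = n.+1%:R * nrm (resolvent T z (y - x)).
  rewrite nrmZ cabsN; congr (_ * _); apply/eqP.
  by rewrite -(eqrXn2 (n := 2)) ?cabs_ge0 // cabs_sqr /= expr0n add0r.
rewrite !nrmN in h3 h4.
have h6 : nrm (resolvent T z w) < e / 3.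
  move: hn; rewrite ltr_pdivrMr // => hn.
  by rewrite -(ltr_pM2l n0); apply: le_lt_trans h1 _.
lra.
Qed.

End Resolvent.
End SelfAdjoint.

(** * Reducing subspaces and boundary values of the resolvent *)

Section Reducing.
Variables (R : realType) (H : completeNormedModType R[i]).
Variable dot : {dot H for Num.conj}.
Hypothesis dot_norm : induces_norm dot.
Variable T : set (H * H).
Hypothesis T_sa : self_adjoint dot T.
Implicit Types (x y v w : H) (z a : R[i]) (t e d l : R).

Let T_sym := sa_symmetric T_sa.

Record reducing (M : set H) : Prop := Reducing {
  red_subspace : linear_subspace M;
  red_closed : closed M;
  red_resolvent : forall z v, complex.Im z != 0 -> M v -> M (resolvent T z v)
}.

Section OneSubspace.
Variable M : set H.
Hypothesis M_red : reducing M.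
Let M_lin := red_subspace M_red.

(** T x is the limit of - z (T - z)^-1 T x = - z (x + z (T - z)^-1 x). *)
Lemma reducing_op x y : M x -> T (x, y) -> M y.
Proof.
move=> Mx Txy; apply: (closed_limit (red_closed M_red)) => e e0.
have [z z0 hz] := resolvent_approx dot_norm T_sa y e0.
exists (- z *: resolvent T z y); last by rewrite nrmB.
apply: (subspaceZ M_lin).
have : resolvent T z (y - z *: x) = x.
  by apply: (resolventE dot_norm T_sa) => //; rewrite subrK.
rewrite (resolventB dot_norm T_sa) // (resolventZ dot_norm T_sa) //.
move/eqP; rewrite subr_eq => /eqP ->.
by apply: (subspaceD M_lin) => //; apply: (subspaceZ M_lin); apply: red_resolvent.
Qed.

(** The symmetry of T evaluates the real part of the inner product of the two
    resolvent vectors. Hence the norm of (T - l - ie)^-1 v increases as e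
    decreases to 0, and its increments control the distances: vectors of bounded
    norm form a Cauchy sequence, without any recourse to a spectral measure. *)
Lemma resolvent_diff_sqr l e d v : e != 0 -> d != 0 ->
  (e + d) * nrm (resolvent T (l +i* e) v - resolvent T (l +i* d) v) ^+ 2 =
  (e - d) * (nrm (resolvent T (l +i* d) v) ^+ 2 - nrm (resolvent T (l +i* e) v) ^+ 2).
Proof.
move=> e0 d0.
have Te := resolventP T_sa v (e0 : complex.Im (l +i* e) != 0).
have Td := resolventP T_sa v (d0 : complex.Im (l +i* d) != 0).
set we := resolvent T (l +i* e) v in Te *; set wd := resolvent T (l +i* d) v in Td *.
rewrite (nrm_sqrB dot_norm).
have key x y s t : T (x, v + (l +i* s) *: x) -> T (y, v + (l +i* t) *: y) ->
    (s + t) * complex.Re (dot x y) = complex.Im (dot x v) + complex.Im (dot y v).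
  move=> Tx Ty; have := congr1 (@complex.Im R) (T_sym Tx Ty).
  rewrite dotDl dotZl dotDr dotZr (dotC dot v y) !ReImE /= => h; lra.
have := key _ _ _ _ Te Td; have := key _ _ _ _ Te Te; have := key _ _ _ _ Td Td.
rewrite -!(nrm_sqr dot_norm) => h1 h2 h3; lra.
Qed.

(** The limit of (T - l - ie)^-1 v as e tends to 0 solves (T - l) w = v because T
    is closed. *)
Lemma bounded_resolvents_range l v C : M v -> 0 <= C ->
  (forall e, 0 < e -> nrm (resolvent T (l +i* e) v) <= C) ->
  exists2 w, M w & T (w, v + l%:C *: w) /\ nrm w <= C.
Proof.
move=> Mv C0 hC.
pose e n : R := n.+1%:R^-1.
have e0 n : 0 < e n by rewrite invr_gt0.
pose f n := resolvent T (l +i* e n) v.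
pose s n := nrm (f n) ^+ 2.
have Im_e n : complex.Im (l +i* e n) != 0 by rewrite /= gt_eqF.
have sC n : s n <= C ^+ 2 by rewrite ler_pXn2r ?nnegrE ?nrm_ge0 // hC.
have diff m n : (m <= n)%N -> nrm (f m - f n) ^+ 2 <= s n - s m.
  rewrite leq_eqVlt => /orP[/eqP ->|mn]; first by rewrite !subrr nrm0 expr0n.
  have emn : e n < e m by rewrite ltf_pV2 ?posrE // ltr_nat.
  have := @resolvent_diff_sqr l (e m) (e n) v.
  rewrite !gt_eqF // -/(f m) -/(f n) -/(s m) -/(s n) => /(_ isT isT) h.
  have := sqr_ge0 (nrm (f m - f n)); move: (e0 m) (e0 n) h emn.
  move: (nrm _ ^+ 2) (s n - s m) (e m) (e n) => q r a b a0 b0 h ba q0.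
  have r0 : 0 <= r.
    rewrite -(@pmulr_rge0 _ (a - b)) ?subr_gt0 // -h mulr_ge0 //; lra.
  rewrite -(ler_pM2l (_ : 0 < a + b)) ?h ?addr_gt0 //; nra.
pose D := range s.
have Dsup : has_sup D.
  by split; [exists (s 0%N), 0%N | exists (C ^+ 2) => _ [n _ <-]].
have sle n : s n <= sup D by apply: ub_le_sup; [case: Dsup | exists n].
have [w hw] : exists w, forall r : R, 0 < r -> exists N, forall n, (N <= n)%N ->
    nrm (w - f n) <= r.
  apply: cauchy_limit => r r0.
  have [_ [N _ <-] hN] := sup_adherent (exprn_gt0 2 r0) Dsup.
  have close m n : (N <= m)%N -> (m <= n)%N -> nrm (f m - f n) <= r.
    move=> Nm mn; rewrite -(ler_pXn2r (n := 2)) ?nnegrE ?nrm_ge0 ?ltW //.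
    have h1 := diff _ _ mn; have h2 := sle n.
    have h3 : s N <= s m.
      by rewrite -subr_ge0; apply: le_trans (diff _ _ Nm); exact: sqr_ge0.
    lra.
  exists N => m n Nm Nn; case/orP: (leq_total m n) => mn; first exact: close.
  by rewrite nrmB; exact: close.
have wC : nrm w <= C.
  apply/ler_addgt0Pr => r r0; have [N hN] := hw r r0.
  have := nrmD (w - f N) (f N); rewrite subrK => h1.
  have := hN N (leqnn N); have := hC _ (e0 N); rewrite -/(f N); lra.
exists w; first apply: (closed_limit (red_closed M_red)) => r r0.
  have [N hN] := hw (r / 2) (divr_gt0 r0 (ltr0n _ 2)).
  exists (f N); first exact: (red_resolvent M_red).
  by apply: le_lt_trans (hN _ (leqnn N)) _; lra.
split=> //; apply: (op_closed dot_norm T_sa) => r r0.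
(* The image of f n misses v + l w by l (w - f n) - i (e n) (f n), of norm at
   most t (|l| + C) when |w - f n| and e n are at most t. *)
have k0 : 0 < `|l| + C + 1 by rewrite ltr_wpDl // addr_ge0.
set k := `|l| + C + 1 in k0.
have [N hN] := hw (r / (2 * k)) (divr_gt0 r0 (mulr_gt0 (ltr0n _ 2) k0)).
have [N' hN'] := natS_gt (2 * k / r).
pose n := maxn N N'.
have rk : r / (2 * k) * k = r / 2 by field; rewrite gt_eqF.
have h1 : nrm (w - f n) <= r / (2 * k) by apply: hN; rewrite leq_maxl.
have h2 : e n <= r / (2 * k).
  rewrite -[leRHS]invrK lef_pV2 ?posrE ?invr_gt0 ?divr_gt0 ?mulr_gt0 //.
  rewrite invf_div; apply: ltW; apply: lt_le_trans hN' _.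
  by rewrite ler_nat ltnS leq_maxr.
have t0 : 0 < r / (2 * k) by rewrite divr_gt0 // mulr_gt0.
set t := r / (2 * k) in rk h1 h2 t0.
have Tn := resolventP T_sa v (Im_e n); rewrite -/(f n) in Tn.
have tk : t * k = t * `|l| + t * C + t by rewrite /k; ring.
have tC : 0 <= t * C by rewrite mulr_ge0 // ltW.
have tl : 0 <= t * `|l| by rewrite mulr_ge0 // ltW.
exists (f n, v + (l +i* e n) *: f n) => //=; split; first lra.
have -> : v + l%:C *: w - (v + (l +i* e n) *: f n) =
    l%:C *: (w - f n) - (0 +i* e n) *: f n.
  have -> : l +i* e n = l%:C + (0 +i* e n).
    by apply: complex_ext => /=; rewrite ?addr0 ?add0r.
  by lincomb R[i]; ring.
have h3 := nrmD (l%:C *: (w - f n)) (- ((0 +i* e n) *: f n)).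
rewrite nrmN !nrmZ cabs_real in h3.
have e_abs : cabs (0 +i* e n) = e n.
  apply/eqP; rewrite -(eqrXn2 (n := 2)) ?cabs_ge0 ?(ltW (e0 n)) //.
  by rewrite cabs_sqr /= expr0n add0r.
rewrite e_abs in h3.
have h4 : `|l| * nrm (w - f n) <= `|l| * t by rewrite ler_wpM2l.
have h5 : e n * nrm (f n) <= t * C.
  by apply: ler_pM => //; [exact: ltW | exact: nrm_ge0 | exact: hC].
lra.
Qed.

(** The condition on the right is visibly closed in l. It implies the one on the
    left by taking for x the vector (T - l + ie)^-1 (T - l - ie)^-1 v, whose
    pairing with v is |(T - l - ie)^-1 v|^2. *)
Lemma range_dual l v C : M v -> 0 <= C ->
  (exists2 w, M w & T (w, v + l%:C *: w) /\ nrm w <= C) <->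
  (forall x y, T (x, y) -> cabs (dot x v) <= C * nrm (y - l%:C *: x)).
Proof.
move=> Mv C0; split=> [[w Mw [Tw wC]] x y Txy|h].
  have -> : dot x v = dot (y - l%:C *: x) w.
    have := T_sym Txy Tw; rewrite dotDr dotZr dotDl dotNl dotZl => ->.
    have -> : Num.conj l%:C = l%:C by apply: complex_ext; rewrite ?ReImE /= ?oppr0.
    ring.
  apply: le_trans (cauchy_schwarz dot_norm _ _) _.
  by rewrite mulrC ler_wpM2r ?nrm_ge0.
apply: bounded_resolvents_range => // e e0.
have Ie : complex.Im (l +i* e) != 0 by rewrite /= gt_eqF.
have Im_e : complex.Im (l -i* e) != 0 by rewrite /= oppr_eq0 gt_eqF.
have Tw := resolventP T_sa v Ie; set w := resolvent _ _ v in Tw *.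
have Tx := resolventP T_sa w Im_e; set x := resolvent _ _ w in Tx.
have := h _ _ Tx.
have -> : dot x v = (nrm w ^+ 2)%:C.
  rewrite -(dotxx dot_norm).
  have := T_sym Tx Tw; rewrite dotDr dotZr dotDl dotZl.
  have -> : Num.conj (l +i* e) = l -i* e by apply: complex_ext; rewrite ?ReImE.
  by move/addIr.
rewrite cabs_real ger0_norm ?sqr_ge0 // => h1.
have := nrm_shift_sqr dot_norm T_sym l (- e) Tx; rewrite addrK => h2.
have h3 : nrm (w + (l -i* e) *: x - l%:C *: x) <= nrm w.
  by rewrite -(ler_pXn2r (n := 2)) ?nnegrE ?nrm_ge0 // h2 lerDl mulr_ge0 ?sqr_ge0.
have {}h1 := le_trans h1 (ler_wpM2l C0 h3).
have [w0|w0] := eqVneq (nrm w) 0; first by rewrite w0.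
by rewrite -(ler_pM2r (x := nrm w)) -?expr2 // lt_def w0 nrm_ge0.
Qed.

Definition bounded_below l c : Prop :=
  forall x y, M x -> T (x, y) -> c * nrm x <= nrm (y - l%:C *: x).

(** A lower bound at l bounds the resolvents at l + ie uniformly in e, so their
    limit exists. *)
Lemma bounded_below_onto l c v : 0 < c -> bounded_below l c -> M v ->
  exists2 w, M w & T (w, v + l%:C *: w) /\ nrm w <= nrm v / c.
Proof.
move=> c0 bb Mv; apply: bounded_resolvents_range => // [|e e0].
  by rewrite divr_ge0 ?nrm_ge0 // ltW.
have Ie : complex.Im (l +i* e) != 0 by rewrite /= gt_eqF.
have Tw := resolventP T_sa v Ie; set w := resolvent _ _ v in Tw *.
have Mw : M w by exact: (red_resolvent M_red).
rewrite ler_pdivlMr // mulrC; apply: le_trans (bb _ _ Mw Tw) _.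
have := nrm_shift_sqr dot_norm T_sym l e Tw; rewrite addrK => h.
by rewrite -(ler_pXn2r (n := 2)) ?nnegrE ?nrm_ge0 // h lerDl mulr_ge0 ?sqr_ge0.
Qed.

Lemma bounded_below_near l c l' : bounded_below l c ->
  bounded_below l' (c - `|l - l'|).
Proof.
move=> bb x y Mx Txy; have := bb _ _ Mx Txy.
have -> : y - l%:C *: x = (y - l'%:C *: x) - (l - l')%:C *: x.
  by rewrite rmorphB /=; lincomb R[i]; ring.
have := nrmD (y - l'%:C *: x) (- ((l - l')%:C *: x)).
rewrite nrmN nrmZ cabs_real mulrBl; lra.
Qed.

End OneSubspace.
End Reducing.

(** * Baire category on a closed set of real numbers *)

(** Nested intervals centred in K, the n-th of which avoids F n; their lengths
    tend to 0, so that their common point belongs to K. *)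
Lemma closed_baire (R : realType) (K : set R) (F : nat -> set R) :
  (forall l : R, (forall e, 0 < e -> exists2 a, K a & `|l - a| < e) -> K l) ->
  (forall n l r, K l -> 0 < r -> exists2 a, K a & `|a - l| < r /\
     exists2 s, 0 < s & forall b, `|b - a| < s -> ~ F n b) ->
  forall l r, K l -> 0 < r ->
    exists2 a, K a & `|a - l| < r /\ forall n, ~ F n a.
Proof.
move=> Kcl nowhere l r Kl r0.
pose good (p : R * R) := K p.1 /\ 0 < p.2.
have step (np : nat * (R * R)) : exists q : R * R, good np.2 ->
    [/\ good q, `|q.1 - np.2.1| + q.2 <= np.2.2, q.2 <= np.1.+1%:R^-1 &
     forall b, `|b - q.1| <= q.2 -> ~ F np.1 b].
  case: np => n [c t] /=.
  have [[Kc t0]|] := pselect (good (c, t)); last by exists (c, t).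
  have [a Ka [ac [s s0 hs]]] := nowhere n c t Kc t0.
  pose q := Num.min (s / 2) (Num.min (t - `|a - c|) n.+1%:R^-1).
  have q1 : q <= s / 2 by rewrite ge_min lexx.
  have q2 : q <= t - `|a - c| by rewrite !ge_min lexx orbT.
  have q3 : q <= n.+1%:R^-1 by rewrite !ge_min lexx !orbT.
  exists (a, q) => _; split => //=.
  - by split => //=; rewrite !lt_min divr_gt0 // subr_gt0 ac invr_gt0 ltr0n.
  - by lra.
  - by move=> b ba; apply: hs; lra.
have [g hg] := choice step.
pose fix s n := if n is m.+1 then g (m, s m) else (l, r / 2).
have s_good n : good (s n).
  elim: n => [|n IH] /=; first by split => //=; rewrite divr_gt0.
  by case: (hg (n, s n) IH).
have s_step n := hg (n, s n) (s_good n).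
have nested m n : (m <= n)%N -> `|(s n).1 - (s m).1| + (s n).2 <= (s m).2.
  elim: n => [|n IH]; first by rewrite leqn0 => /eqP ->; rewrite subrr normr0 add0r.
  rewrite leq_eqVlt => /orP[/eqP ->|]; first by rewrite subrr normr0 add0r.
  rewrite ltnS => /IH h; case: (s_step n) => _ /= h' _ _.
  have := ler_distD (s n).1 (s n.+1).1 (s m).1; rewrite /=; lra.
pose A := range (fun n => (s n).1 - (s n).2).
have A_ub m : ubound A ((s m).1 + (s m).2).
  move=> _ [n _ <-]; case: (s_good m) (s_good n) => _ m0 [_ n0].
  have [mn|nm] := leqP m n.
    by have := nested _ _ mn; have := ler_norm ((s n).1 - (s m).1); lra.
  have := nested _ _ (ltnW nm); rewrite distrC.
  by have := ler_norm ((s n).1 - (s m).1); lra.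
have A_sup : has_sup A.
  by split; [exists ((s 0%N).1 - (s 0%N).2), 0%N | exists ((s 0%N).1 + (s 0%N).2)].
pose x := sup A.
have x_near n : `|x - (s n).1| <= (s n).2.
  have h1 : x <= (s n).1 + (s n).2 by apply: ge_sup; [case: A_sup | exact: A_ub].
  have h2 : (s n).1 - (s n).2 <= x by apply: ub_le_sup; [case: A_sup | exists n].
  by rewrite ler_norml; apply/andP; split; lra.
exists x.
  apply: Kcl => e e0; have [n hn] := natS_gt e^-1.
  exists (s n.+1).1; first by case: (s_good n.+1).
  apply: le_lt_trans (x_near _) _; case: (s_step n) => _ _ h _.
  by apply: le_lt_trans h _; rewrite -[ltRHS]invrK ltf_pV2 ?posrE ?invr_gt0.
split.
  apply: le_lt_trans (x_near 0%N) _.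
  by rewrite /= ltr_pdivrMr // ltr_pMr // ltr1n.
by move=> n; case: (s_step n) => _ _ _; apply; exact: (x_near n.+1).
Qed.

(** * The spectrum of a reduced self-adjoint operator *)

Section Spectrum.
Variables (R : realType) (H : completeNormedModType R[i]).
Variable dot : {dot H for Num.conj}.
Hypothesis dot_norm : induces_norm dot.
Variable T : set (H * H).
Hypothesis T_sa : self_adjoint dot T.
Implicit Types (x y v w : H) (z a : R[i]) (t e d l : R).

Let T_lin := sa_subspace T_sa.
Let T_sym := sa_symmetric T_sa.

(** The Cayley transform (T - l - id) (T - l + id)^-1, normalized so that the
    point l of the spectrum corresponds to -1. *)
Definition cayley l d v : H := v - (0 +i* (2 * d)) *: resolvent T (l -i* d) v.

Lemma cayley_graph l d x y : d != 0 -> T (x, y) ->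
  cayley l d (y - (l -i* d) *: x) = y - (l +i* d) *: x.
Proof.
move=> d0 Txy; rewrite /cayley (@resolventE _ _ _ dot_norm _ T_sa _ x) ?subrK //=.
  have -> : l +i* d = l -i* d + 0 +i* (2 * d).
    by apply: complex_ext => /=; rewrite ?addr0 //; ring.
  by lincomb R[i]; ring.
by rewrite oppr_eq0.
Qed.

Lemma cayley_arg l d v : d != 0 -> exists x y,
  T (x, y) /\ v = y - (l -i* d) *: x.
Proof.
move=> d0; have Id : complex.Im (l -i* d) != 0 by rewrite /= oppr_eq0.
exists (resolvent T (l -i* d) v), (v + (l -i* d) *: resolvent T (l -i* d) v).
by rewrite addrK; split => //; apply: (resolventP T_sa).
Qed.

Lemma cayley_iso l d v : d != 0 -> nrm (cayley l d v) = nrm v.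
Proof.
move=> d0; have [x [y [Txy ->]]] := cayley_arg l v d0.
by rewrite cayley_graph // (nrm_shift dot_norm T_sym).
Qed.

Lemma cayley_lin l d a v w : d != 0 ->
  cayley l d (a *: v + w) = a *: cayley l d v + cayley l d w.
Proof.
move=> d0; rewrite /cayley (resolvent_lin dot_norm T_sa) /= ?oppr_eq0 //.
by lincomb R[i]; ring.
Qed.

(** The inverse z = (t - i) / (t + i) of the map from the line to the circle
    takes |t| < 1 onto an arc that contains |z + 1| < 1; there 1 - z is bounded
    away from 0, which keeps transported solutions bounded. *)
Lemma arc_to_interval (z : R[i]) : cabs z = 1 -> cabs (z + 1) < 1 ->
  exists t : R, [/\ `|t| < 1, t%:C * (1 - z) = 'i%C * (1 + z) & 1 <= cabs (1 - z)].
Proof.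
move=> z1 z2; have := cabs_sqr z; have := cabs_sqr (z + 1); have := cabs_sqr (1 - z).
rewrite z1; case: z z1 z2 => a b /= z1 z2.
rewrite ?add0r ?addr0 ?sub0r ?sqrrN => h1 h2 h3.
have h4 : cabs (a +i* b + 1) ^+ 2 < 1 by rewrite expr_lt1 ?cabs_ge0.
have a2 : a < - (1 / 2).
  by rewrite h2 in h4; rewrite expr1n in h3; nra.
have a1 : 0 < 1 - a by lra.
have bb : b ^+ 2 = (1 - a) * (1 + a) by rewrite expr1n in h3; lra.
exists (- b / (1 - a)); split.
- rewrite -(ltr_pXn2r (n := 2)) ?nnegrE // real_normK ?num_real // expr1n.
  rewrite expr_div_n sqrrN bb ltr_pdivrMr ?exprn_gt0 //; nra.
- by apply: complex_ext; rewrite ?ReImE /=; field: bb; rewrite gt_eqF.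
- rewrite -(ler_pXn2r (n := 2)) ?nnegrE ?cabs_ge0 // expr1n h1; nra.
Qed.

(** Solutions of (T - l') w = v become solutions for the Cayley transform at all
    points of the arc around -1, so that v has no spectral mass near l and the
    Cayley transform moves v away from -v. *)
Lemma solvable_interval l d N v : 0 < d -> 0 <= N ->
  (forall l', `|l' - l| < d -> exists2 w, T (w, v + l'%:C *: w) & nrm w <= N) ->
  nrm v <= 2 * nrm (cayley l d v + v).
Proof.
move=> d0 N0 h; have d0' : d != 0 by rewrite gt_eqF.
have bound : 0 <= nrm v + 2 * d * N.
  by rewrite addr_ge0 ?nrm_ge0 // !mulr_ge0 // ltW.
have := @arc_lower_bound _ _ _ dot_norm (cayley l d)
  (fun a x y => cayley_lin l a x y d0') (fun x => cayley_iso l x d0')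
  (-1) 1 _ v ler01 bound.
rewrite scaleN1r expr1n mul1r => hv.
rewrite -(ler_pXn2r (n := 2)) ?nnegrE ?mulr_ge0 ?nrm_ge0 // exprMn.
apply: le_trans (hv _) _ => {hv}; last first.
  by rewrite opprK; have := sqr_ge0 (nrm (cayley l d v + v)); lra.
move=> z z1; rewrite opprK => z2.
have [t [t1 tz z3]] := arc_to_interval z1 z2.
have td : `|l + t * d - l| < d.
  by rewrite addrC addKr normrM (gtr0_norm d0) gtr_pMl.
have [w Tw wN] := h _ td.
have z0 : 1 - z != 0 by rewrite -cabs_gt0; apply: lt_le_trans z3; exact: ltr01.
have := opZ T_lin (1 - z)^-1 Tw; set x := _ *: w => Tx.
(* (T - l + id) x with x = w / (1 - z), since on such a vector cayley - z acts
   as (1 - z) (T - l') x = v. *)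
exists ((1 - z)^-1 *: (v + (l + t * d)%:C *: w) - (l -i* d) *: x).
  rewrite cayley_graph // /x.
  have lid : l -i* d = l%:C - 'i%C * d%:C.
    by apply: complex_ext; rewrite ?ReImE /=; ring.
  have lid' : l +i* d = l%:C + 'i%C * d%:C.
    by apply: complex_ext; rewrite ?ReImE /=; ring.
  rewrite lid lid' rmorphD rmorphM /=; lincomb R[i]; first by field.
  transitivity ((1 - z)^-1 * (d%:C * (t%:C * (1 - z) - 'i%C * (1 + z)))).
    by field.
  by rewrite tz subrr !mulr0.
have -> : (1 - z)^-1 *: (v + (l + t * d)%:C *: w) - (l -i* d) *: x =
    (1 - z)^-1 *: (v + (t * d +i* d) *: w).
  have -> : l -i* d = (l + t * d)%:C - (t * d +i* d).
    by apply: complex_ext; rewrite ?ReImE /=; ring.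
  by rewrite /x; lincomb R[i]; ring.
rewrite nrmZ cabsV; apply: (@le_trans _ _ (nrm (v + (t * d +i* d) *: w))).
  rewrite mulrC ler_pdivrMr ?cabs_gt0 // ler_peMr ?nrm_ge0 //.
apply: le_trans (nrmD _ _) _; rewrite lerD2l nrmZ.
apply: ler_pM => //; [exact: cabs_ge0 | exact: nrm_ge0 |].
have -> : t * d +i* d = (t * d)%:C + 'i%C * d%:C.
  by apply: complex_ext; rewrite ?ReImE /=; ring.
apply: le_trans (cabsD _ _) _; rewrite cabsM cabsi mul1r !cabs_real normrM.
rewrite (gtr0_norm d0).
have : `|t| * d <= 1 * d by rewrite ler_pM2r // ltW.
lra.
Qed.

(** For v = (T - l + id) x one has cayley v + v = 2 (T - l) x and d |x| <= |v|. *)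
Lemma cayley_lower_bound M l d : reducing T M -> 0 < d ->
  (forall v, M v -> nrm v <= 2 * nrm (cayley l d v + v)) ->
  bounded_below T M l (d / 4).
Proof.
move=> M_red d0 h x y Mx Txy; have d0' : d != 0 by rewrite gt_eqF.
have My : M y by exact: (reducing_op dot_norm T_sa M_red Mx Txy).
have /h : M (y - (l -i* d) *: x).
  have Mlin := red_subspace M_red.
  by apply: (subspaceB Mlin) => //; exact: (subspaceZ Mlin).
rewrite cayley_graph //.
have -> : y - (l +i* d) *: x + (y - (l -i* d) *: x) = (2%:R)%:C *: (y - l%:C *: x).
  have -> : l +i* d = l%:C + 'i%C * d%:C by apply: complex_ext; rewrite ?ReImE /=; ring.
  have -> : l -i* d = l%:C - 'i%C * d%:C by apply: complex_ext; rewrite ?ReImE /=; ring.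
  by rewrite rmorph_nat; lincomb R[i]; ring.
rewrite nrmZ cabs_real ger0_norm // => h1.
have := @nonreal_lower_bound _ _ _ dot_norm _ T_sym (l -i* d) x (y - (l -i* d) *: x).
rewrite subrK /= normrN (gtr0_norm d0) => /(_ Txy); lra.
Qed.

Section Reduced.
Variable M : set H.
Hypothesis M_red : reducing T M.
Let M_lin := red_subspace M_red.

(** The approximate point spectrum of T on M; for a self-adjoint operator it is
    the whole spectrum. *)
Definition real_spectrum : set R :=
  [set l | forall c, 0 < c -> ~ bounded_below T M l c].

Lemma real_spectrum_closed l :
  (forall e, 0 < e -> exists2 a, real_spectrum a & `|l - a| < e) ->
  real_spectrum l.
Proof.
move=> h c c0 bb; have [a aK la] := h _ c0.
apply: (aK (c - `|l - a|)); first by rewrite subr_gt0.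
exact: bounded_below_near bb.
Qed.

Lemma not_real_spectrum l : ~ real_spectrum l ->
  exists2 c, 0 < c & bounded_below T M l c.
Proof.
move=> h; apply: contrapT => h'; apply: h => c c0 bb.
by apply: h'; exists c.
Qed.

Lemma bounded_below_le l c c' : c' <= c -> bounded_below T M l c ->
  bounded_below T M l c'.
Proof.
move=> cc bb x y Mx Txy; apply: le_trans (bb x y Mx Txy).
by rewrite ler_wpM2r ?nrm_ge0.
Qed.

(** Off the real axis T - z is invertible on M because M reduces T; at a real
    point a lower bound alone gives invertibility. *)
Lemma spectrumE z : spectrum M (restriction T M) z <->
  complex.Im z = 0 /\ real_spectrum (complex.Re z).
Proof.
have shiftP w v : op_shift (restriction T M) z (w, v) <-> M w /\ T (w, v + z *: w).
  split=> [[[x y] [Txy /= Mx] [<- <-]]|[Mw Tw]]; first by rewrite subrK.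
  by exists (w, v + z *: w) => //=; rewrite addrK.
have ran_sub v : ran (op_shift (restriction T M) z) v -> M v.
  move=> [[w v'] /shiftP[Mw Tw] /= <-].
  rewrite -[v'](addrK (z *: w)); apply: (subspaceB M_lin).
    exact: (reducing_op dot_norm T_sa M_red Mw Tw).
  exact: (subspaceZ M_lin).
split=> [spec|[Iz zK] [/= ranM inj [c hc]]].
  have Iz : complex.Im z = 0.
    apply: contrapT => /eqP Iz; apply: spec; split.
    - apply/seteqP; split=> v; first exact: ran_sub.
      move=> Mv; exists (resolvent T z v, v) => //; apply/shiftP; split.
        exact: red_resolvent.
      exact: (resolventP T_sa).
    - move=> x x' y /shiftP[_ h] /shiftP[_ h'].
      exact: (nonreal_inj dot_norm T_sa Iz h h').
    - exists (`|complex.Im z|^-1)%:C => x y /shiftP[_ h].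
      rewrite !nrmE -rmorphM lecR mulrC ler_pdivlMr ?normr_gt0 // mulrC.
      exact: (nonreal_lower_bound dot_norm T_sym h).
  split=> // c c0 bb; apply: spec.
  have zE : z = (complex.Re z)%:C by apply: complex_ext.
  have low x y : op_shift (restriction T M) z (x, y) -> c * nrm x <= nrm y.
    by move=> /shiftP[Mx Tx]; have := bb _ _ Mx Tx; rewrite -zE addrK.
  split.
  - apply/seteqP; split=> v; first exact: ran_sub.
    move=> Mv.
    have [w Mw [Tw _]] := bounded_below_onto dot_norm T_sa M_red c0 bb Mv.
    by exists (w, v) => //; apply/shiftP; rewrite zE.
  - move=> x x' y h h'; apply/eqP; rewrite -subr_eq0; apply/eqP/nrm_le0.
    rewrite -(pmulr_rle0 _ c0).
    have /low : op_shift (restriction T M) z (x - x', 0); last by rewrite nrm0.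
    move/shiftP: h => [Mx Tx]; move/shiftP: h' => [Mx' Tx']; apply/shiftP; split.
      exact: (subspaceB M_lin).
    have := opB T_lin Tx Tx'; congr T; congr pair; lincomb R[i]; ring.
  - exists (c^-1)%:C => x y /low h.
    by rewrite !nrmE -rmorphM lecR mulrC ler_pdivlMr // mulrC.
have zE : z = (complex.Re z)%:C by apply: complex_ext.
apply: (zK (cabs c + 1)^-1) => [|x y Mx Txy].
  by rewrite invr_gt0 ltr_wpDl ?cabs_ge0.
have c1 : 0 < cabs c + 1 by rewrite ltr_wpDl ?cabs_ge0.
rewrite mulrC ler_pdivrMr // -zE.
have /hc : op_shift (restriction T M) z (x, y - z *: x).
  by apply/shiftP; rewrite subrK.
rewrite !nrmE lecE => /andP[_]; rewrite Re_mul /= mulr0 subr0 => h.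
apply: le_trans h _; rewrite mulrC ler_wpM2l ?nrm_ge0 //.
have := abs_Re_cabs c; have := ler_norm (complex.Re c); lra.
Qed.

Lemma uniform_bounded_below l d : 0 < d ->
  (forall l', `|l' - l| <= d -> ~ real_spectrum l') ->
  exists2 c, 0 < c & forall l', `|l' - l| <= d -> bounded_below T M l' c.
Proof.
move=> d0 h.
have /compact_near_coveringP := @segment_compact R (l - d) (l + d).
move=> /(_ nat \oo (fun n l' => bounded_below T M l' n.+1%:R^-1)).
have inI l' : (`|l' - l| <= d) = (l' \in `[l - d, l + d]).
  by rewrite in_itv /= ler_distl.
case=> [l' /=|N _ hN].
  rewrite -inI => /h /not_real_spectrum[c c0 bb].
  have c2 : 0 < c / 2 by rewrite divr_gt0.
  have [N hN] := natS_gt (c / 2)^-1.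
  exists (ball l' (c / 2), [set n | (N <= n)%N]); first split.
  - exact: nbhsx_ballx.
  - by exists N.
  move=> [a n] /= [la Nn]; apply: bounded_below_le (bounded_below_near a bb).
  move: la; rewrite /ball /= => la.
  have h1 : n.+1%:R^-1 <= c / 2.
    rewrite -[leRHS]invrK lef_pV2 ?posrE ?invr_gt0 //.
    by apply: ltW; apply: lt_le_trans hN _; rewrite ler_nat.
  by move: n.+1%:R^-1 h1 la => t h1 la; lra.
exists N.+1%:R^-1 => // l' ll'; apply: (hN N) => //=.
by rewrite -inI.
Qed.

(** Compactness provides some lower bound that is uniform in the gap, and hence
    bounded solutions for every v in M; [solvable_interval] then replaces this
    unspecified bound by one that depends on the length of the gap only. *)
Lemma gap_bounded_below l d : 0 < d ->
  (forall l', `|l' - l| <= d -> ~ real_spectrum l') -> bounded_below T M l (d / 4).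
Proof.
move=> d0 h; have [c c0 hc] := uniform_bounded_below d0 h.
apply: cayley_lower_bound => // v Mv.
apply: (@solvable_interval l d (nrm v / c)) => //.
  by rewrite divr_ge0 ?nrm_ge0 // ltW.
move=> l' /ltW /hc bb.
have [w _ [Tw wN]] := bounded_below_onto dot_norm T_sa M_red c0 bb Mv.
by exists w.
Qed.

End Reduced.
End Spectrum.

(** * A cyclic vector is outside the range of T - l for most l *)

Section CyclicVector.
Variables (R : realType) (H : completeNormedModType R[i]).
Variable dot : {dot H for Num.conj}.
Hypothesis dot_norm : induces_norm dot.
Variable T : set (H * H).
Hypothesis T_sa : self_adjoint dot T.
Variable M : set H.
Hypothesis M_red : reducing T M.
Variable u : H.
Hypothesis Mu : M u.
Hypothesis u_cyclic :
  M `<=` closure (linear_span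
    [set resolvent T z u | z in [set z : R[i] | z \isn't Num.real]]).
Implicit Types (x y v w : H) (z : R[i]) (a t e d l C : R).

Let T_lin := sa_subspace T_sa.
Let M_lin := red_subspace M_red.

(** For the spectral measure mu of u this says that the integral of
    1 / (s - l)^2 with respect to mu is at most C^2 and that mu has no atom at l. *)
Definition solvable C l : Prop :=
  exists2 w, M w & T (w, u + l%:C *: w) /\ nrm w <= C.

(** By [range_dual], unsolvability is witnessed by one strict inequality. *)
Lemma not_solvable_open C a : 0 <= C -> ~ solvable C a ->
  exists2 s, 0 < s & forall b, `|b - a| < s -> ~ solvable C b.
Proof.
move=> C0 nsol.
have [x [y [Txy lt]]] : exists x y,
    T (x, y) /\ C * nrm (y - a%:C *: x) < cabs (dot x u).
  apply: contrapT => h; apply: nsol; apply/(range_dual dot_norm T_sa M_red a Mu C0).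
  move=> x y Txy; rewrite leNgt; apply/negP => lt; apply: h; by exists x, y.
set g := cabs (dot x u) - C * nrm (y - a%:C *: x).
have g0 : 0 < g by rewrite subr_gt0.
have k0 : 0 < C * nrm x + 1 by rewrite ltr_wpDl // mulr_ge0 // nrm_ge0.
exists (g / (C * nrm x + 1)); first by rewrite divr_gt0.
move=> b; rewrite ltr_pdivlMr // => ba.
move/(range_dual dot_norm T_sa M_red b Mu C0) => /(_ _ _ Txy); apply/negP.
rewrite -ltNge.
have -> : y - b%:C *: x = (y - a%:C *: x) - (b - a)%:C *: x.
  by rewrite rmorphB /=; lincomb R[i]; ring.
have := nrmD (y - a%:C *: x) (- ((b - a)%:C *: x)).
rewrite nrmN nrmZ cabs_real => h.
have := ler_wpM2l C0 h.
have := normr_ge0 (b - a); move: ba; rewrite /g; nra.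
Qed.

(** From the spectrum to the gaps: if l lies at distance d > 0 from the spectrum
    and a is a point of the spectrum with |l - a| < 2 d, then
    w_l = w_a + (l - a) (T - l)^-1 w_a, and the norm of (T - l)^-1 is at most 8 / d
    by [gap_bounded_below]. This gives the factor 1 + 2 * 8 = 17. *)
Lemma solvable_near_gap l1 r C l :
  (forall a, real_spectrum T M a -> `|a - l1| < r -> solvable C a) ->
  0 <= C -> real_spectrum T M l1 -> `|l - l1| < r / 2 -> solvable (17 * C) l.
Proof.
move=> h C0 Kl1 ll1.
have [Kl|/not_real_spectrum[c c0 bb]] := pselect (real_spectrum T M l).
  have [|w Mw [Tw wC]] := h l Kl; first by have := normr_ge0 (l - l1); lra.
  by exists w => //; split => //; lra.
pose D := [set `|l - a| | a in real_spectrum T M].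
have Dc : lbound D c.
  move=> _ [a aK <-]; rewrite leNgt; apply/negP => la.
  by apply: (aK (c - `|l - a|)); [rewrite subr_gt0 | exact: bounded_below_near bb].
have Dinf : has_inf D by split; [exists `|l - l1|, l1 | exists c].
set d := inf D.
have d0 : 0 < d by apply: lt_le_trans c0 _; apply: lb_le_inf; case: Dinf.
have dle a : real_spectrum T M a -> d <= `|l - a|.
  by move=> aK; apply: ge_inf; [case: Dinf | exists a].
have [_ [a aK <-] la] : exists2 q, D q & q < d + Num.min d (r / 2 - `|l - l1|).
  by apply: inf_adherent => //; rewrite lt_min d0 subr_gt0.
have la1 : `|l - a| < 2 * d.
  apply: lt_le_trans la _.
  by have := ge_min d d (r / 2 - `|l - l1|); rewrite lexx /=; lra.
have la2 : `|l - a| < d + (r / 2 - `|l - l1|).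
  by apply: lt_le_trans la _; rewrite lerD2l ge_min lexx orbT.
have [|w Mw [Tw wC]] := h a aK.
  have := dle _ Kl1; have := ler_distD l a l1; rewrite (distrC a l); lra.
have gap : bounded_below T M l (d / 2 / 4).
  apply: (gap_bounded_below dot_norm T_sa M_red); first by rewrite divr_gt0.
  move=> l' ll' l'K; have := dle _ l'K; rewrite distrC; lra.
have d8 : 0 < d / 2 / 4 by rewrite !divr_gt0.
have [y My [Ty yC]] := bounded_below_onto dot_norm T_sa M_red d8 gap Mw.
exists (w + (l - a)%:C *: y).
  by apply: (subspaceD M_lin) => //; exact: (subspaceZ M_lin).
split.
  have := opD T_lin Tw (opZ T_lin (l - a)%:C Ty); congr T; congr pair.
  by rewrite rmorphB /=; lincomb R[i]; ring.
apply: le_trans (nrmD _ _) _; rewrite nrmZ cabs_real.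
have y8 : d * nrm y <= 8 * nrm w.
  by move: yC; rewrite ler_pdivlMr //; lra.
have : `|l - a| * nrm y <= 2 * d * nrm y by rewrite ler_wpM2r ?nrm_ge0 // ltW.
lra.
Qed.

(** Otherwise the equations (T - l) w = u have bounded solutions for all l in an
    interval around l1. The resolvents of T commute with T, so the same holds
    with u replaced by any (T - z)^-1 u and by their linear combinations v, with a
    bound that depends on v. The conclusion of [solvable_interval] does not depend
    on that bound, so it extends to the closure M of these combinations and gives
    a lower bound for T - l1, against l1 being in the spectrum. *)
Lemma spectrum_has_unsolvable l1 r C : real_spectrum T M l1 -> 0 < r -> 0 <= C ->
  exists2 a, real_spectrum T M a & `|a - l1| < r /\ ~ solvable C a.
Proof.
move=> Kl1 r0 C0; apply: contrapT => none.
have h a : real_spectrum T M a -> `|a - l1| < r -> solvable C a.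
  by move=> aK al; apply: contrapT => na; apply: none; exists a.
set d := r / 2; have d0 : 0 < d by rewrite divr_gt0.
apply: (Kl1 (d / 4)); first by rewrite divr_gt0.
apply: (cayley_lower_bound dot_norm T_sa M_red d0).
pose W : set H := [set v | exists2 N, 0 <= N & forall l, `|l - l1| < d ->
  exists2 w, T (w, v + l%:C *: w) & nrm w <= N].
have W_lin : linear_subspace W.
  apply: subspaceP => [|a v v' [N N0 hN] [N' N0' hN']].
    exists 0 => // l _; exists 0; last by rewrite nrm0.
    by rewrite scaler0 addr0; exact: subspace0 T_lin.
  exists (cabs a * N + N'); first by rewrite addr_ge0 ?mulr_ge0 ?cabs_ge0.
  move=> l ll; have [w Tw wN] := hN l ll; have [w' Tw' wN'] := hN' l ll.
  exists (a *: w + w').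
    by have := opZD T_lin a Tw Tw'; congr T; congr pair; lincomb R[i]; ring.
  apply: le_trans (nrmD _ _) _; rewrite nrmZ lerD // ler_wpM2l ?cabs_ge0 //.
have WR z : complex.Im z != 0 -> W (resolvent T z u).
  move=> z0; exists (17 * C / `|complex.Im z|).
    by rewrite divr_ge0 // mulr_ge0.
  move=> l ll; have [w Mw [Tw wC]] := solvable_near_gap h C0 Kl1 ll.
  have Tw' := resolventP T_sa w z0; set w' := resolvent T z w in Tw'.
  have -> : resolvent T z u = w + (z - l%:C) *: w'.
    apply: (resolventE dot_norm T_sa z0).
    have := opD T_lin Tw (opZ T_lin (z - l%:C) Tw'); congr T; congr pair.
    by lincomb R[i]; ring.
  exists w'; first by move: Tw'; congr T; congr pair; lincomb R[i]; ring.
  rewrite ler_pdivlMr ?normr_gt0 // mulrC; apply: le_trans wC.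
  exact: (resolvent_bound dot_norm T_sa).
have W_bound v : W v -> nrm v <= 2 * nrm (cayley T l1 d v + v).
  by case=> N N0 hN; exact: (solvable_interval dot_norm T_sa d0 N0 hN).
move=> v /u_cyclic cv; apply/ler_addgt0Pr => e e0.
have [v' Wv' vv'] := closure_limit cv (divr_gt0 e0 (ltr0n _ 5)).
have {}Wv' : W v'.
  apply: (span_sub W_lin) Wv' => _ [z /= z0 <-]; apply: WR.
  by rewrite -nonreal_Im.
have := W_bound _ Wv'.
have d0' : d != 0 by rewrite gt_eqF.
have cayleyB : cayley T l1 d v' + v' =
    (cayley T l1 d v + v) + - (cayley T l1 d (v - v') + (v - v')).
  have -> : v - v' = (-1) *: v' + v by rewrite scaleN1r addrC.
  by rewrite (cayley_lin dot_norm T_sa) //; lincomb R[i]; ring.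
have := nrmD (cayley T l1 d v + v) (- (cayley T l1 d (v - v') + (v - v'))).
have := nrmD (cayley T l1 d (v - v')) (v - v').
have := nrmD (v - v') v'.
rewrite -cayleyB nrmN (cayley_iso dot_norm T_sa) // subrK; lra.
Qed.

Lemma unsolvable_dense l r : real_spectrum T M l -> 0 < r ->
  exists2 a, real_spectrum T M a & `|a - l| < r /\ forall n : nat, ~ solvable n%:R a.
Proof.
apply: closed_baire; first exact: real_spectrum_closed.
move=> n l' r' Kl r0.
have [a aK [al na]] := spectrum_has_unsolvable Kl r0 (ler0n R n).
by exists a => //; split => //; exact: not_solvable_open.
Qed.

End CyclicVector.

(** * Self-adjointness from the two deficiency equations *)

Section Criterion.
Variables (R : realType) (H : completeNormedModType R[i]).
Variable dot : {dot H for Num.conj}.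
Hypothesis dot_norm : induces_norm dot.

Lemma range_subspace (T : set (H * H)) (z : R[i]) : linear_subspace T ->
  linear_subspace [set v | exists x, T (x, v + z *: x)].
Proof.
move=> T_lin; apply: subspaceP => [|a v w [x Tx] [y Ty]].
  by exists 0; rewrite scaler0 addr0; exact: subspace0 T_lin.
exists (a *: x + y); have := opZD T_lin a Tx Ty; congr T; congr pair.
by lincomb R[i]; ring.
Qed.

(** For any non-real z the range of T - z is closed, and a vector orthogonal to
    it is an eigenvector of the adjoint of T for the conjugate of z. The two
    equations at i and -i suffice to show that T contains its adjoint. *)
Lemma self_adjoint_criterion (T : set (H * H)) : linear_subspace T ->
  symmetric_operator dot T -> dense (domain T) ->
  (forall v, exists x, T (x, v + 'i%C *: x)) ->
  (forall v, exists x, T (x, v + (- 'i%C) *: x)) ->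
  self_adjoint dot T.
Proof.
move=> T_lin T_sym T_dense onto onto'; split => // z z0.
have Ni0 : complex.Im (- 'i%C : R[i]) != 0 by rewrite /= oppr_eq0 oner_eq0.
have Tcl := symmetric_onto_closed dot_norm T_lin T_sym Ni0 onto'.
apply: (closed_subspace_full dot_norm (range_subspace z T_lin)).
  exact: (closed_range dot_norm T_lin T_sym z0 Tcl).
move=> w hw.
have w_adj x y : T (x, y) -> dot w y = dot (Num.conj z *: w) x.
  move=> Txy; have := hw (y - z *: x).
  rewrite dotDr dotNr dotZr dotZl => h; apply/eqP; rewrite -subr_eq0; apply/eqP.
  by apply: h; exists x; rewrite subrK.
(* w is compared with the element x0 of the domain of T that has the same image
   under T* + i: the difference is orthogonal to the range of T - i. *)
have [x0 Tx0] := onto' (Num.conj z *: w + 'i%C *: w).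
set y0 := _ + _ *: x0 in Tx0.
have wx0 : w = x0.
  apply/eqP; rewrite -subr_eq0 -nrm_eq0 -(sqrf_eq0 (nrm _)) (nrm_sqr dot_norm).
  have [x Tx] := onto (w - x0).
  suff -> : dot (w - x0) (w - x0) = 0 by [].
  rewrite -[X in dot _ X](addrK ('i%C *: x)) dotDr dotNr dotZr.
  set y := (w - x0 + _) in Tx *.
  rewrite dotDl dotNl (w_adj _ _ Tx) -(T_sym _ _ _ _ Tx0 Tx) -dotNl -dotDl.
  have -> : Num.conj z *: w - y0 = - 'i%C *: (w - x0).
    by rewrite /y0; lincomb R[i]; ring.
  have -> : Num.conj ('i%C : R[i]) = - 'i%C.
    by apply: complex_ext; rewrite ?ReImE /= ?oppr0.
  rewrite dotZl; ring.
apply: (nonreal_eigenvector dot_norm T_sym (z := Num.conj z)).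
  by rewrite Im_conjc oppr_eq0.
by move: Tx0; rewrite /y0 -wx0; congr T; congr pair; lincomb R[i]; ring.
Qed.

End Criterion.

(** * The cyclic subspace of a vector *)

Section Cyclic.
Variables (R : realType) (H : completeNormedModType R[i]).
Variable dot : {dot H for Num.conj}.
Hypothesis dot_norm : induces_norm dot.
Variable T : set (H * H).
Hypothesis T_sa : self_adjoint dot T.
Implicit Types (x y v w : H) (z : R[i]) (t e : R).

Let T_lin := sa_subspace T_sa.

Lemma resolvent_identity z z' v : complex.Im z != 0 -> complex.Im z' != 0 ->
  (z' - z) *: resolvent T z' (resolvent T z v) = resolvent T z' v - resolvent T z v.
Proof.
move=> z0 z0'; rewrite -(resolventZ dot_norm T_sa) //.
apply: (resolventE dot_norm T_sa) => //.
have := opB T_lin (resolventP T_sa v z0') (resolventP T_sa v z0).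
by congr T; congr pair; lincomb R[i]; ring.
Qed.

(** The point z' = z + i t Im z is not real for t > 0, and by the resolvent
    identity (T - z')^-1 v tends to (T - z)^-1 v as t tends to 0. *)
Lemma resolvent_mem_limit (M : set H) z v : closed M -> complex.Im z != 0 ->
  (forall z', complex.Im z' != 0 -> z' != z -> M (resolvent T z' v)) ->
  M (resolvent T z v).
Proof.
move=> Mcl z0 h; apply: (closed_limit Mcl) => e e0.
set w := resolvent T z v.
have [n hn] := natS_gt (nrm w / e); set t : R := n.+1%:R^-1.
have t0 : 0 < t by rewrite invr_gt0.
pose b := complex.Im z.
have Ib : complex.Im (z + 'i%C * (t * b)%:C) = b * (1 + t).
  by rewrite !ReImE /= /b; ring.
have t1 : 0 < 1 + t by lra.
have z'0 : complex.Im (z + 'i%C * (t * b)%:C) != 0.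
  by rewrite Ib mulf_neq0 // gt_eqF.
set z' := z + _ in Ib z'0.
have zz' : z' - z = 'i%C * (t * b)%:C by rewrite /z' addrC addKr.
exists (resolvent T z' v).
  apply: h => //; rewrite -subr_eq0 zz' -cabs_eq0 cabsM cabsi mul1r cabs_real.
  by rewrite normr_eq0 mulf_neq0 // gt_eqF.
rewrite nrmB -resolvent_identity // zz' nrmZ cabsM cabsi mul1r cabs_real normrM.
have := resolvent_bound dot_norm T_sa w z'0.
rewrite Ib normrM (gtr0_norm t1) (gtr0_norm t0).
set q := nrm (resolvent T z' _) => h1.
have q0 : 0 <= q by exact: nrm_ge0.
have b0 : 0 <= `|b| by exact: normr_ge0.
have h2 : `|b| * q <= nrm w.
  by apply: le_trans h1; rewrite -mulrA ler_wpM2l // ler_peMl //; lra.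
rewrite -mulrA; apply: (@le_lt_trans _ _ (t * nrm w)).
  by rewrite ler_wpM2l // ltW.
by rewrite ltr_pdivrMr // in hn; rewrite /t mulrC ltr_pdivrMr // mulrC.
Qed.

Variable u : H.

Lemma cyclicity_space_subspace : linear_subspace (cyclicity_space T u).
Proof. exact/closure_subspace/span_subspace. Qed.

Lemma cyclicity_space_closed : closed (cyclicity_space T u).
Proof. exact: closed_closure. Qed.

Lemma cyclicity_space_resolvent z : complex.Im z != 0 ->
  cyclicity_space T u (resolvent T z u).
Proof.
move=> z0; apply: subset_closure; apply: sub_span; exists z => //=.
by rewrite nonreal_Im.
Qed.

Lemma cyclicity_space_vector : cyclicity_space T u u.
Proof.
apply: (closed_limit cyclicity_space_closed) => e e0.
have [z z0 hz] := resolvent_approx dot_norm T_sa u e0.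
exists (- z *: resolvent T z u); last by rewrite nrmB.
by apply: (subspaceZ cyclicity_space_subspace); exact: cyclicity_space_resolvent.
Qed.

Lemma cyclicity_space_min (M : set H) : linear_subspace M -> closed M ->
  (forall z, complex.Im z != 0 -> M (resolvent T z u)) ->
  cyclicity_space T u `<=` M.
Proof.
move=> Mlin Mcl h v cv; apply: (closed_limit Mcl) => e e0.
have [w sw vw] := closure_limit cv e0; exists w => //.
by apply: (span_sub Mlin) sw => _ [z /= z0 <-]; apply: h; rewrite -nonreal_Im.
Qed.

(** The resolvent identity writes (T - z)^-1 (T - z')^-1 u as a combination of two
    generators when z and z' differ; the case z = z' is a limit of these. *)
Lemma cyclicity_space_reducing : reducing T (cyclicity_space T u).
Proof.
split; [exact: cyclicity_space_subspace | exact: cyclicity_space_closed |].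
have M_lin := cyclicity_space_subspace; have M_cl := cyclicity_space_closed.
move=> z v z0 cv.
have gen z' z'' : complex.Im z' != 0 -> complex.Im z'' != 0 -> z' != z'' ->
    cyclicity_space T u (resolvent T z'' (resolvent T z' u)).
  move=> z0' z0'' zz.
  have -> : resolvent T z'' (resolvent T z' u) =
      (z'' - z')^-1 *: (resolvent T z'' u - resolvent T z' u).
    rewrite -resolvent_identity // scalerA mulVf ?scale1r //.
    by rewrite subr_eq0 eq_sym.
  apply: (subspaceZ M_lin); apply: (subspaceB M_lin); exact: cyclicity_space_resolvent.
apply: (closed_limit M_cl) => e e0.
have k0 : 0 < `|complex.Im z| by rewrite normr_gt0.
have [w sw vw] := closure_limit cv (mulr_gt0 e0 k0).
exists (resolvent T z w); last first.
  rewrite -(resolventB dot_norm T_sa) // -(ltr_pM2l k0) (mulrC _ e).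
  exact: le_lt_trans (resolvent_bound dot_norm T_sa _ z0) vw.
have lin : linear_subspace [set x | cyclicity_space T u (resolvent T z x)].
  apply: subspaceP => [|a x y hx hy] /=.
    by rewrite (resolvent0 dot_norm T_sa z0); exact: subspace0 M_lin.
  by rewrite (resolvent_lin dot_norm T_sa) //; exact: (subspaceZD M_lin).
apply: (span_sub lin) sw => _ [z' /= z0' <-]; rewrite nonreal_Im in z0'.
have [zz|zz] := eqVneq z' z; last exact: gen.
apply: resolvent_mem_limit => // z'' z0'' zz''; apply: gen => //.
by rewrite zz eq_sym.
Qed.

End Cyclic.

(** * Angles *)

Section Angles.
Variable R : realType.
Implicit Types t : R.

Lemma cabs_expi t : cabs (expi t) = 1.
Proof.
apply/eqP; rewrite -(pexpr_eq1 (n := 2)) ?cabs_ge0 // cabs_sqr /expi /=.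
by rewrite cos2Dsin2.
Qed.

Lemma expi_surj (z : R[i]) : cabs z = 1 ->
  exists t, 0 <= t < pi /\ expi (- (2 * t)) = z.
Proof.
move=> z1; have := cabs_sqr z; rewrite z1 expr1n.
case: z z1 => a b /= _ ab.
have a1 : -1 <= a <= 1.
  by rewrite -ler_norml -(ler_pXn2r (n := 2)) ?nnegrE // real_normK ?num_real //; nra.
have [/andP[c0 cpi] ca] := acos_def a1.
have sb : sin (acos a) = `|b|.
  by rewrite sin_acos // -sqrtr_sqr; congr Num.sqrt; rewrite ab; ring.
have pi0 := pi_gt0 R.
have [b0|b0] := leP b 0.
  exists (acos a / 2); split; first by apply/andP; split; lra.
  rewrite mulrC divfK // /expi cosN sinN ca sb ler0_norm //.
  by rewrite opprK.
have c0' : acos a != 0.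
  apply: contraTneq b0 => ac0; have /eqP := sb.
  by rewrite ac0 sin0 eq_sym normr_eq0 => /eqP ->; rewrite ltxx.
have {c0'} c0' : 0 < acos a by rewrite lt_def c0' c0.
exists (pi - acos a / 2); split; first by apply/andP; split; lra.
have -> : - (2 * (pi - acos a / 2)) = acos a - pi *+ 2 by rewrite mulr2n; field.
by rewrite /expi cosB sinB cos2pi sin2pi ca sb gtr0_norm // !mulr1 !mulr0 addr0 subr0.
Qed.

Lemma expi_inj t t' : 0 <= t < pi -> 0 <= t' < pi ->
  expi (- (2 * t)) = expi (- (2 * t')) -> t = t'.
Proof.
wlog le : t t' / t <= t' => [h ht ht' e|/andP[t0 tp] /andP[t0' tp'] [e1 e2]].
  have [tt|tt] := leP t t'; first exact: h.
  by apply/esym/h => //; exact: ltW.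
apply/eqP; rewrite eq_le le leNgt; apply/negP => lt.
have /andP : 0 < t' - t < pi by apply/andP; split; lra.
case=> d0 dpi; have := sin_gt0_pi (x := t' - t); rewrite d0 dpi => /(_ isT).
have c1 : cos ((t' - t) *+ 2) = 1.
  have -> : (t' - t) *+ 2 = - (2 * t) - - (2 * t') by rewrite mulr2n; ring.
  rewrite cosB e1 e2 -!expr2 cos2Dsin2 //.
have := cos2Dsin2 (t' - t); rewrite cos_mulr2n in c1 => c2.
have : sin (t' - t) ^+ 2 = 0 by lra.
by move/eqP; rewrite sqrf_eq0 => /eqP ->; rewrite ltxx.
Qed.

End Angles.

(** * Self-adjoint extensions with deficiency indices (1, 1) *)

Section Extensions.
Variables (R : realType) (H : completeNormedModType R[i]).
Variable dot : {dot H for Num.conj}.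
Hypothesis dot_norm : induces_norm dot.
Variable B : set (H * H).
Hypotheses (B_linear : linear_operator B) (B_dense : densely_defined B).
Hypotheses (B_closed : closed_operator B) (B_symmetric : symmetric_operator dot B).
Hypothesis deficiency_plus : one_dimensional (deficiency_space dot B 'i%C).
Hypothesis deficiency_minus : one_dimensional (deficiency_space dot B (- 'i%C)).
Variables up um : H.
Hypotheses (up_deficiency : deficiency_space dot B 'i%C up) (up_unit : `|up| = 1).
Hypotheses (um_deficiency : deficiency_space dot B (- 'i%C) um) (um_unit : `|um| = 1).
Implicit Types (x y v w : H) (z a c : R[i]) (t : R).

Let B_lin : linear_subspace B. Proof. by case: B_linear. Qed.
Let conji : Num.conj ('i%C : R[i]) = - 'i%C.
Proof. by apply: complex_ext; rewrite ?ReImE /= ?oppr0. Qed.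
Let Ii : complex.Im ('i%C : R[i]) != 0. Proof. by rewrite /= oner_eq0. Qed.
Let INi : complex.Im (- 'i%C : R[i]) != 0.
Proof. by rewrite /= oppr_eq0 oner_eq0. Qed.

Notation ext t := (extension B up um t).
Notation phase t := (expi (- (2 * t))).

Lemma unit_nrm v : `|v| = 1 -> nrm v = 1.
Proof. by rewrite /nrm => ->. Qed.

Lemma up_neq0 : up != 0.
Proof. by rewrite -nrm_eq0 (unit_nrm up_unit) oner_eq0. Qed.

Lemma expi_neq0 t : (expi t : R[i]) != 0.
Proof. by rewrite -cabs_eq0 cabs_expi oner_eq0. Qed.

Lemma deficiency_adjoint z v x y : deficiency_space dot B z v -> B (x, y) ->
  dot v y = - Num.conj z * dot v x.
Proof.
move=> vz Bxy; have := vz (y - (- z) *: x).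
rewrite dotDr dotNr dotZr rmorphN => h; apply/eqP; rewrite -subr_eq0; apply/eqP.
rewrite -[RHS]h; last by exists (x, y - - z *: x) => //; exists (x, y).
ring.
Qed.

Lemma dot_up_B x y : B (x, y) -> dot up y = 'i%C * dot up x.
Proof. by move/(deficiency_adjoint up_deficiency) ->; rewrite conji opprK. Qed.

Lemma dot_um_B x y : B (x, y) -> dot um y = - 'i%C * dot um x.
Proof.
by move/(deficiency_adjoint um_deficiency) ->; rewrite rmorphN /= conji opprK.
Qed.

Lemma dot_B_up x y : B (x, y) -> dot y up = - 'i%C * dot x up.
Proof. by move/dot_up_B => h; rewrite (dotC dot y) h rmorphM /= conji -(dotC dot). Qed.

Lemma dot_B_um x y : B (x, y) -> dot y um = 'i%C * dot x um.
Proof.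
move/dot_um_B => h; rewrite (dotC dot y) h rmorphM rmorphN /= conji opprK.
by rewrite -(dotC dot).
Qed.

(** Green's identity on the domain of the adjoint of B, which is spanned by the
    domain of B and the two deficiency vectors. The two boundary coefficients
    enter with opposite signs, so that symmetry forces the ratio c / a to have
    modulus 1. *)
Lemma green x y a c x' y' a' c' : B (x, y) -> B (x', y') ->
  dot (y + (a * 'i%C) *: up - (c * 'i%C) *: um) (x' + a' *: up + c' *: um) -
  dot (x + a *: up + c *: um) (y' + (a' * 'i%C) *: up - (c' * 'i%C) *: um) =
  2 * 'i%C * (a * Num.conj a' - c * Num.conj c').
Proof.
move=> Bxy Bxy'; rewrite !(dotDl, dotDr, dotNl, dotNr, dotZl, dotZr).
rewrite (B_symmetric Bxy Bxy') (dot_up_B Bxy') (dot_um_B Bxy').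
rewrite (dot_B_up Bxy) (dot_B_um Bxy) !rmorphM /= conji.
rewrite !(dotxx dot_norm) (unit_nrm up_unit) (unit_nrm um_unit) expr1n.
rewrite (_ : 1%:C = 1) //; ring.
Qed.

Lemma conj_unit z : cabs z = 1 -> z * Num.conj z = 1.
Proof.
move=> z1; have := cabs_sqr z; rewrite z1 expr1n => h.
by apply: complex_ext; rewrite ?ReImE /= ?h; ring.
Qed.

Lemma extE t x y a : B (x, y) ->
  ext t (x + a *: up + (a * phase t) *: um,
         y + (a * 'i%C) *: up - (a * 'i%C * phase t) *: um).
Proof. by move=> Bxy; exists x, y, a. Qed.

Lemma B_sub_ext t x y : B (x, y) -> ext t (x, y).
Proof. by move/(extE t 0); rewrite !mul0r !scale0r !addr0 subr0. Qed.

Lemma ext_subspace t : linear_subspace (ext t).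
Proof.
apply: subspaceP => [|d p q [x [y [a [Bxy ->]]]] [x' [y' [a' [Bxy' ->]]]]].
  by apply: B_sub_ext; exact: subspace0 B_lin.
exists (d *: x + x'), (d *: y + y'), (d * a + a'); split; first exact: opZD.
by rewrite [LHS]surjective_pairing; congr pair; rewrite /=; lincomb R[i]; ring.
Qed.

Lemma ext_symmetric t : symmetric_operator dot (ext t).
Proof.
move=> x y x' y' [b [d [a [Bbd [-> ->]]]]] [b' [d' [a' [Bbd' [-> ->]]]]].
apply/eqP; rewrite -subr_eq0; apply/eqP.
rewrite [a * 'i%C * phase t]mulrAC [a' * 'i%C * phase t]mulrAC green //.
rewrite rmorphM /=; have := conj_unit (cabs_expi (- (2 * t))) => h.
by rewrite mulrACA h; ring.
Qed.

Lemma ext_dense t : dense (domain (ext t)).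
Proof.
move=> O O0 oO; have [x [Ox [[x1 y] Bxy /= x1E]]] := B_dense O0 oO.
exists x; split => //; exists (x1, y) => //; exact: B_sub_ext.
Qed.

(** The range of B - z is closed and its orthogonal complement is a line. *)
Lemma range_sum z u0 v : complex.Im z != 0 -> u0 != 0 ->
  deficiency_space dot B (- z) u0 ->
  one_dimensional (deficiency_space dot B (- z)) ->
  exists x a, B (x, v - a *: u0 + z *: x).
Proof.
move=> z0 u00 du0 [g g0 gE].
have Bcl := closed_graph_closed B_closed.
have [k [x Bx] hk] := projection dot_norm v (range_subspace z B_lin)
  (closed_range dot_norm B_lin B_symmetric z0 Bcl).
have : deficiency_space dot B (- z) (v - k).
  move=> _ [[w1 w2] [[x' y'] Bxy' [_ <-]] /= <-]; apply: hk.
  by exists x'; rewrite opprK subrK.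
rewrite gE => -[b _ vk]; rewrite gE in du0; case: du0 => d _ dE.
have d0 : d != 0 by apply: contraNneq u00 => d0; rewrite -dE d0 scale0r.
exists x, (b / d); rewrite -dE scalerA divfK // vk.
by rewrite (_ : v - (v - k) = k) //; lincomb R[i]; ring.
Qed.

(** The images of u_+ + e^(-2it) u_- under T_t - i and T_t + i are -2i e^(-2it) u_-
    and 2i u_+, which span the complements of the ranges of B - i and B + i. *)
Lemma ext_self_adjoint t : self_adjoint dot (ext t).
Proof.
have um0 : um != 0 by rewrite -nrm_eq0 (unit_nrm um_unit) oner_eq0.
have e0 := expi_neq0 (- (2 * t)).
have ii := mulii R.
apply: (self_adjoint_criterion dot_norm (ext_subspace t) (@ext_symmetric t)
  (@ext_dense t)) => v.
  have [x [a Bx]] := @range_sum 'i%C um v Ii um0 um_deficiency deficiency_minus.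
  pose b := a * 'i%C / (2 * phase t).
  exists (x + b *: up + (b * phase t) *: um).
  have := extE t b Bx; congr (ext t); congr pair.
  lincomb R[i]; rewrite /b.
  all: try ring.
  by field: ii.
have dplus : one_dimensional (deficiency_space dot B (- - 'i%C)) by rewrite opprK.
have upd : deficiency_space dot B (- - 'i%C) up by rewrite opprK.
have [x [a Bx]] := @range_sum (- 'i%C) up v INi up_neq0 upd dplus.
pose b := - a * 'i%C / 2.
exists (x + b *: up + (b * phase t) *: um).
have := extE t b Bx; congr (ext t); congr pair.
lincomb R[i]; rewrite /b.
all: try ring.
by field: ii.
Qed.

End Extensions.

(** * Eigenvalues of the extensions and the range of T - l *)

Section Eigenvalues.
Variables (R : realType) (H : completeNormedModType R[i]).
Variable dot : {dot H for Num.conj}.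
Hypothesis dot_norm : induces_norm dot.
Variable B : set (H * H).
Hypotheses (B_linear : linear_operator B) (B_dense : densely_defined B).
Hypotheses (B_closed : closed_operator B) (B_symmetric : symmetric_operator dot B).
Hypothesis deficiency_plus : one_dimensional (deficiency_space dot B 'i%C).
Hypothesis deficiency_minus : one_dimensional (deficiency_space dot B (- 'i%C)).
Variables up um : H.
Hypotheses (up_deficiency : deficiency_space dot B 'i%C up) (up_unit : `|up| = 1).
Hypotheses (um_deficiency : deficiency_space dot B (- 'i%C) um) (um_unit : `|um| = 1).
Implicit Types (x y v w : H) (z a c : R[i]) (t l : R).

Let B_lin : linear_subspace B. Proof. by case: B_linear. Qed.

Notation ext t := (extension B up um t).
Notation phase t := (expi (- (2 * t))).

Let ext_sa t : self_adjoint dot (ext t).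
Proof. exact: ext_self_adjoint. Qed.

Let ext_lin t : linear_subspace (ext t). Proof. exact: (sa_subspace (ext_sa t)). Qed.
Let ext_sym t : symmetric_operator dot (ext t).
Proof. exact: (sa_symmetric (ext_sa t)). Qed.
Let e_neq0 t : (phase t : R[i]) != 0. Proof. exact: expi_neq0. Qed.
Let up0 : up != 0. Proof. exact: up_neq0. Qed.

Lemma adjoint_eigenvector t z w : ext t (w, up + z *: w) ->
  exists x y a, [/\ B (x, y),
    w = x + a *: up + (a * phase t) *: um &
    up + z *: w = y + (a * 'i%C) *: up - (a * 'i%C * phase t) *: um].
Proof. by move=> [x [y [a [Bxy [wE zE]]]]]; exists x, y, a. Qed.

(** Otherwise u_+ itself would be in the domain of T_t, as an eigenvector for the
    non-real number i. *)
Lemma not_ext_eigenvector t z w : z != 'i%C ->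
  ext t (w, up + z *: w) ->
  ~ ext t (up + (z - 'i%C) *: w, z *: (up + (z - 'i%C) *: w)).
Proof.
move=> zi Tw Tx; have : ext t (up, 'i%C *: up).
  have := opB (ext_lin t) Tx (opZ (ext_lin t) (z - 'i%C) Tw).
  by congr (ext t); congr pair; lincomb R[i]; ring.
move/(nonreal_eigenvector dot_norm (@ext_sym t)) => h.
by move: up0; rewrite h ?eqxx //= oner_eq0.
Qed.

(** Krein's formula on the vector u_+. A solution w of (T_t' - z) w = u_+ yields the
    eigenvector u_+ + (z - i) w of the adjoint of B for z; subtracting the multiple
    k of u_+ that brings it into the domain of T_t gives, up to the factor
    (z - i) k, the solution for T_t. *)
Lemma krein t t' z w : complex.Im z != 0 -> z != 'i%C ->
  ext t' (w, up + z *: w) ->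
  exists a c, w = a *: up + c *: resolvent (ext t) z up.
Proof.
move=> z0 zi Tw; have [x [y [a [Bxy wE zwE]]]] := adjoint_eigenvector Tw.
have s0 : z - 'i%C != 0 by rewrite subr_eq0.
set s := z - 'i%C in s0.
pose b := s * a * phase t' / phase t.
pose k := 1 + s * a - b.
have et := e_neq0 t.
have TX : ext t (up + s *: w - k *: up,
    s *: up + s *: (z *: w) - (k * 'i%C - 'i%C) *: up).
  have := @extE _ _ _ up um t (s *: x) (s *: y) b (opZ B_lin s Bxy).
  congr (ext t); congr pair.
    by rewrite wE /k /b; lincomb R[i]; try ring; field.
  have -> : s *: y =
      s *: (up + z *: w - ((a * 'i%C) *: up - (a * 'i%C * phase t') *: um)).
    by rewrite zwE; lincomb R[i]; ring.
  by rewrite /k /b; lincomb R[i]; try ring; field.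
have X2 : s *: up + s *: (z *: w) - (k * 'i%C - 'i%C) *: up =
    (s * k) *: up + z *: (up + s *: w - k *: up).
  by rewrite /s; lincomb R[i]; ring.
rewrite X2 in TX.
have k0 : k != 0.
  apply/eqP => k0; move: TX; rewrite k0 mulr0 !scale0r add0r subr0 => TX.
  have X0 := nonreal_eigenvector dot_norm (@ext_sym t) z0 TX.
  apply: (not_ext_eigenvector zi Tw); rewrite -/s X0 scaler0.
  exact: subspace0 (ext_lin t').
have sk : s * k != 0 by rewrite mulf_neq0.
have RE : resolvent (ext t) z up = (s * k)^-1 *: (up + s *: w - k *: up).
  apply: (resolventE dot_norm (ext_sa t) z0).
  have := opZ (ext_lin t) (s * k)^-1 TX; congr (ext t); congr pair.
  by lincomb R[i]; try ring; field; rewrite k0.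
exists (- (1 - k) / s), k; rewrite RE; lincomb R[i]; try ring; field; by rewrite ?k0.
Qed.

Lemma cyclicity_space_sub t t' :
  cyclicity_space (ext t') up `<=` cyclicity_space (ext t) up.
Proof.
have M_lin := cyclicity_space_subspace (ext t) up.
have M_cl := @cyclicity_space_closed _ _ (ext t) up.
apply: cyclicity_space_min => // z z0.
have off_i z' : complex.Im z' != 0 -> z' != 'i%C ->
    cyclicity_space (ext t) up (resolvent (ext t') z' up).
  move=> z'0 z'i.
  have [a [c ->]] := krein t z'0 z'i (resolventP (ext_sa t') up z'0).
  apply: (subspaceD M_lin); apply: (subspaceZ M_lin).
    exact: (cyclicity_space_vector dot_norm (ext_sa t)).
  exact: cyclicity_space_resolvent.
have [zi|zi] := eqVneq z 'i%C; last exact: off_i.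
apply: (resolvent_mem_limit dot_norm (ext_sa t') M_cl z0) => z' z'0.
by rewrite zi; exact: off_i.
Qed.

Lemma cyclicity_space_indep t t' :
  cyclicity_space (ext t') up = cyclicity_space (ext t) up.
Proof. by apply/seteqP; split; exact: cyclicity_space_sub. Qed.

(** An eigenvector of B is an eigenvector of every extension and is orthogonal to
    u_+, hence to the cyclic subspace. *)
Lemma no_eigenvector t l x : cyclicity_space (ext t) up x ->
  B (x, l%:C *: x) -> x = 0.
Proof.
move=> Mx Bx.
have conjl : Num.conj l%:C = l%:C by apply: complex_ext; rewrite ?ReImE /= ?oppr0.
have upx : dot up x = 0.
  have := dot_up_B up_deficiency Bx; rewrite dotZr conjl => /eqP.
  rewrite -subr_eq0 -mulrBl mulf_eq0 => /orP[|/eqP //].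
  rewrite subr_eq0 => /eqP/(congr1 (@complex.Im R)) /= /eqP.
  by rewrite eq_sym oner_eq0.
suff : [set v | dot v x = 0] x.
  by move=> /= xx; apply/eqP; rewrite -nrm_eq0 -sqrf_eq0 (nrm_sqr dot_norm) xx.
apply: (cyclicity_space_min (T := ext t) (u := up)) Mx.
- apply: subspaceP => [|a v w /= hv hw]; first exact: dot0l.
  by rewrite dotDl dotZl hv hw mulr0 addr0.
- move=> v cv /=; apply/eqP; rewrite -cabs_eq0 eq_le cabs_ge0 andbT.
  apply/ler_addgt0Pr => d d0; rewrite add0r.
  have k0 : 0 < nrm x + 1 by rewrite ltr_wpDl ?nrm_ge0.
  have [w /= wx vw] := closure_limit cv (divr_gt0 d0 k0).
  have -> : dot v x = dot (v - w) x by rewrite dotDl dotNl wx subr0.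
  apply: le_trans (cauchy_schwarz dot_norm _ _) _.
  rewrite ltr_pdivlMr // in vw; apply: le_trans (ltW vw).
  by rewrite ler_wpM2l ?nrm_ge0 // lerDl.
- move=> z z0 /=; have Tw := resolventP (ext_sa t) up z0.
  have := ext_sym Tw (B_sub_ext up um t Bx).
  rewrite dotDl dotZl dotZr conjl upx add0r => /eqP.
  rewrite -subr_eq0 -mulrBl mulf_eq0 => /orP[|/eqP //].
  rewrite subr_eq0 => /eqP zl; by move: z0; rewrite zl eqxx.
Qed.

(** The vector X = u_+ + (l - i) w satisfies B* X = l X. As l is real, Green's
    identity says that its boundary coefficients have the same modulus, so X
    belongs to the domain of some extension; it is not the one of t0, by
    [not_ext_eigenvector]. *)
Lemma eigenvalue_of_solution t0 l w :
  cyclicity_space (ext t0) up w -> ext t0 (w, up + l%:C *: w) ->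
  exists2 t, 0 <= t < pi & t != t0 /\
    is_eigenvalue (restriction (ext t) (cyclicity_space (ext t0) up)) l%:C.
Proof.
move=> Mw Tw; have [x [y [a [Bxy wE zwE]]]] := adjoint_eigenvector Tw.
set M := cyclicity_space _ _ in Mw *.
have M_lin := cyclicity_space_subspace (ext t0) up.
have li : l%:C != 'i%C :> R[i].
  by apply/eqP => /(congr1 (@complex.Im R)) /= /eqP; rewrite eq_sym oner_eq0.
have nT := not_ext_eigenvector li Tw.
set s := l%:C - 'i%C in nT *; set X := up + s *: w in nT *.
have MX : M X.
  apply: (subspaceD M_lin); first exact: (cyclicity_space_vector dot_norm (ext_sa t0)).
  exact: (subspaceZ M_lin).
pose a' := 1 + s * a; pose c' := s * a * phase t0.
have XE : X = s *: x + a' *: up + c' *: um.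
  by rewrite /X wE /a' /c'; lincomb R[i]; ring.
have lXE : l%:C *: X = s *: y + (a' * 'i%C) *: up - (c' * 'i%C) *: um.
  have -> : s *: y =
      s *: (up + l%:C *: w - ((a * 'i%C) *: up - (a * 'i%C * phase t0) *: um)).
    by rewrite zwE; lincomb R[i]; ring.
  by rewrite /X /a' /c' /s; lincomb R[i]; ring.
have Bs := opZ B_lin s Bxy.
have ac : a' * Num.conj a' = c' * Num.conj c'.
  have := green dot_norm B_symmetric up_deficiency up_unit um_deficiency um_unit
    a' c' a' c' Bs Bs.
  rewrite -XE -lXE dotZl dotZr (_ : Num.conj l%:C = l%:C); last first.
    by apply: complex_ext; rewrite ?ReImE /= ?oppr0.
  rewrite subrr => /esym/eqP; rewrite mulf_eq0 mulf_eq0 pnatr_eq0 /=.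
  by rewrite -cabs_eq0 cabsi oner_eq0 /= subr_eq0 => /eqP.
have aJ b : b * Num.conj b = (cabs b ^+ 2)%:C.
  by apply: complex_ext; rewrite ?ReImE /= ?cabs_sqr; ring.
have abs_ac : cabs a' = cabs c'.
  apply/eqP; rewrite -(eqrXn2 (n := 2)) ?cabs_ge0 //; apply/eqP.
  by apply: complexI; rewrite -!aJ.
have X0 : X != 0.
  apply: contra_notN nT => /eqP ->; rewrite scaler0; exact: subspace0 (ext_lin t0).
have a'0 : a' != 0.
  apply: contraNneq X0 => a0; have /eqP := abs_ac.
  rewrite a0 cabs0 eq_sym cabs_eq0 => /eqP c0.
  apply/eqP/(no_eigenvector MX (l := l)).
  have := Bs; congr B; congr pair.
    by rewrite XE a0 c0; lincomb R[i]; ring.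
  by rewrite lXE a0 c0; lincomb R[i]; ring.
have [t [t_range tE]] : exists t, 0 <= t < pi /\ phase t = c' / a'.
  by apply: expi_surj; rewrite cabsM cabsV -abs_ac divff // cabs_eq0.
have TX : ext t (X, l%:C *: X).
  have := @extE _ _ _ up um t _ _ a' Bs; rewrite tE; congr (ext t); congr pair.
    by rewrite XE; lincomb R[i]; try ring; field.
  by rewrite lXE; lincomb R[i]; try ring; field.
exists t => //; split; first by apply/eqP => tt0; apply: nT; rewrite -tt0.
by exists X.
Qed.

(** An eigenvector X for the parameter t differs from an element of the domain of
    T_t0 by a multiple k u_+ of u_+, with k <> 0, and T_t0 - l maps that element to
    (l - i) k u_+. *)
Lemma solution_of_eigenvalue t0 t l : phase t != phase t0 ->
  is_eigenvalue (restriction (ext t) (cyclicity_space (ext t0) up)) l%:C ->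
  exists2 w, cyclicity_space (ext t0) up w & ext t0 (w, up + l%:C *: w).
Proof.
move=> tt0 [X X0 [/= TX MX]].
have M_lin := cyclicity_space_subspace (ext t0) up.
case: TX => x [y [a [Bxy [XE lXE]]]].
have a0 : a != 0.
  apply: contraNneq X0 => a0; apply/eqP/(no_eigenvector MX (l := l)).
  have := Bxy; congr B; rewrite lXE XE a0; congr pair; lincomb R[i]; ring.
have et0 := e_neq0 t0.
pose k := a * (1 - phase t / phase t0).
have k0 : k != 0.
  rewrite mulf_neq0 // subr_eq0; apply: contraNneq tt0 => h.
  by rewrite -[phase t](divfK et0) -h mul1r.
have li : l%:C - 'i%C != 0 :> R[i].
  rewrite subr_eq0; apply/eqP => /(congr1 (@complex.Im R)) /= /eqP.
  by rewrite eq_sym oner_eq0.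
have Tw : ext t0 (X - k *: up, l%:C *: (X - k *: up) + ((l%:C - 'i%C) * k) *: up).
  have := @extE _ _ _ up um t0 _ _ (a * phase t / phase t0) Bxy.
  congr (ext t0); congr pair.
    by rewrite XE /k; lincomb R[i]; try ring; field.
  rewrite scalerBr lXE /k; lincomb R[i]; try ring; field; by [].
exists (((l%:C - 'i%C) * k)^-1 *: (X - k *: up)).
  apply: (subspaceZ M_lin); apply: (subspaceB M_lin) => //.
  by apply: (subspaceZ M_lin); exact: (cyclicity_space_vector dot_norm (ext_sa t0)).
have := opZ (ext_lin t0) ((l%:C - 'i%C) * k)^-1 Tw; congr (ext t0); congr pair.
by lincomb R[i]; try ring; field; rewrite k0.
Qed.

End Eigenvalues.

(** * Topology of a set of complex numbers *)

Section ComplexTopology.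
Variable R : realType.

Lemma complex_openP (A : set R[i]^o) : open A <->
  forall z : R[i], A z ->
    exists2 s : R, 0 < s & forall w : R[i], cabs (w - z) < s -> A w.
Proof.
have ballE (z w : R[i]^o) (s : R) : ball z s%:C w <-> cabs (w - z) < s.
  by rewrite -ball_normE /= (cabsE (z - w)) ltcR cabsB.
rewrite openE; split=> [Aop z /Aop /nbhs_ballP[[s s'] /= s0 sA]|h z /h[s s0 sA]].
  move: s0; rewrite ltcE /= => /andP[/eqP s'0 s0]; exists s => // w wz; apply: sA.
  by rewrite s'0 ballE.
apply/nbhs_ballP; exists s%:C; first by rewrite /= ltcR.
by move=> w /ballE; exact: sA.
Qed.

End ComplexTopology.

Theorem theorem4p4 (R : realType) (H : completeNormedModType R[i])
    (dot : {dot H for Num.conj}) (dot_norm : induces_norm dot)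
    (B : set (H * H)) (B_linear : linear_operator B)
    (B_dense : densely_defined B) (B_closed : closed_operator B)
    (B_symmetric : symmetric_operator dot B)
    (deficiency_plus : one_dimensional (deficiency_space dot B 'i%C))
    (deficiency_minus : one_dimensional (deficiency_space dot B (- 'i%C)))
    (up um : H)
    (up_deficiency : deficiency_space dot B 'i%C up) (up_unit : `|up| = 1)
    (um_deficiency : deficiency_space dot B (- 'i%C) um) (um_unit : `|um| = 1)
    (theta1 : R) (theta1_range : 0 <= theta1 < pi)
    (M : set H) (M_def : M = cyclicity_space (extension B up um theta1) up)
    (theta0 : R) (theta0_range : 0 <= theta0 < pi) :
  let sigma : set R[i]^o :=
    spectrum M (restriction (extension B up um theta0) M) in
  let S : set (set_type sigma) :=
    [set l | forall theta : R, 0 <= theta < pi -> theta != theta0 ->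
      ~ is_eigenvalue (restriction (extension B up um theta) M) (set_val l)] in
  Gdelta S /\ dense S.
Proof.
move=> sigma S.
have ext_sa t : self_adjoint dot (extension B up um t) by exact: ext_self_adjoint.
have T_sa := ext_sa theta0; pose T := extension B up um theta0.
have ME : M = cyclicity_space T up.
  rewrite M_def; exact: (cyclicity_space_indep dot_norm B_linear B_dense B_closed
    B_symmetric deficiency_plus deficiency_minus up_deficiency up_unit
    um_deficiency um_unit).
have M_red : reducing T M.
  by rewrite ME; exact: (cyclicity_space_reducing dot_norm T_sa).
have Mup : M up by rewrite ME; exact: (cyclicity_space_vector dot_norm T_sa).
have specP z : sigma z <-> complex.Im z = 0 /\ real_spectrum T M (complex.Re z).
  exact: (spectrumE dot_norm T_sa M_red).
have eigenvalueP (l : R) :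
    (exists n : nat, solvable T M up n%:R l) <->
    (exists2 t : R, 0 <= t < pi & t != theta0 /\
      is_eigenvalue (restriction (extension B up um t) M) l%:C).
  split=> [[n [w Mw [Tw _]]]|[t t_range [tt0 eig]]].
    rewrite ME in Mw *; exact: (eigenvalue_of_solution dot_norm B_linear B_dense
      B_closed B_symmetric deficiency_plus deficiency_minus up_deficiency up_unit
      um_deficiency um_unit Mw Tw).
  have ett0 : expi (- (2 * t)) != expi (- (2 * theta0)) :> R[i].
    by apply: contra tt0 => /eqP /(expi_inj t_range theta0_range) ->.
  rewrite ME in eig *.
  have [w Mw Tw] := solution_of_eigenvalue dot_norm B_linear B_dense
      B_closed B_symmetric deficiency_plus deficiency_minus up_deficiency up_unit
      um_deficiency um_unit ett0 eig.
  have [n hn] := natS_gt (nrm w).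
  by exists n.+1; exists w => //; split => //; exact: ltW.
have SE (l : set_type sigma) :
    S l <-> forall n : nat, ~ solvable T M up n%:R (complex.Re (set_val l)).
  have [Il _] := (specP (set_val l)).1 (set_valP l).
  have lE : set_val l = (complex.Re (set_val l))%:C by apply: complex_ext.
  split=> [Sl n sol|nsol t t_range tt0 eig].
    have [t t_range [tt0]] := (eigenvalueP _).1 (ex_intro _ n sol).
    by rewrite -lE; exact: Sl.
  have [|n sol] := (eigenvalueP (complex.Re (set_val l))).2.
    by exists t => //; split => //; rewrite -lE.
  exact: nsol sol.
split.
  exists (fun n => [set l : set_type sigma |
    ~ solvable T M up n%:R (complex.Re (set_val l))]); last first.
    by apply/seteqP; split=> l => [/SE h n _|h]; [exact: h | apply/SE => n; exact: h].
  move=> n; exists [set z : R[i]^o | ~ solvable T M up n%:R (complex.Re z)] => //.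
  apply/complex_openP => z /= nsol.
  have [s s0 hs] := not_solvable_open dot_norm T_sa M_red Mup (ler0n R n) nsol.
  exists s => // w wz; apply: hs; apply: le_lt_trans wz.
  by rewrite -Re_opp -Re_add; exact: abs_Re_cabs.
move=> O [l Ol] [Q openQ OE].
rewrite -OE /= in Ol.
have [s s0 sQ] := (complex_openP Q).1 openQ _ Ol.
have [Il Kl] := (specP (set_val l)).1 (set_valP l).
have cyc : M `<=` closure (linear_span
    [set resolvent T z up | z in [set z : R[i] | z \isn't Num.real]]).
  by rewrite ME.
have [a Ka [al na]] := unsolvable_dense dot_norm T_sa M_red Mup cyc Kl s0.
have sa : sigma a%:C by apply/specP.
exists (SigSub (mem_set sa)); split.
  rewrite -OE /=; apply: sQ.
  have -> : set_val l = (complex.Re (set_val l))%:C by apply: complex_ext.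
  by rewrite -rmorphB cabs_real.
by apply/SE => n /=; exact: na.
Qed.
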